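(* Let $\mathcal{H}_1,\mathcal{H}_2,\mathcal{K}$ be real Hilbert spaces, $0<\sigma\le\beta<\infty$, $f:\mathcal{H}_1\to\mathbb{R}\cup\{\infty\}$ and $g:\mathcal{H}_2\to\mathbb{R}\cup\{\infty\}$ proper, closed and convex, $\mathcal{A}:\mathcal{H}_1\to\mathcal{K}$ and $\mathcal{B}:\mathcal{H}_2\to\mathcal{K}$ bounded linear operators, and $c\in\mathcal{K}$. Suppose $f$ is $\beta$-smooth and $\sigma$-strongly convex and $\mathcal{A}$ is surjective. Let $\theta>0$ satisfy $\|\mathcal{A}^*\mu\|\ge\theta\|\mu\|$ for all $\mu\in\mathcal{K}$. Define $$d_1(\mu)=f^*(-\mathcal{A}^*\mu)+\langle c,\mu\rangle,\qquad d_2(\mu)=g^*(-\mathcal{B}^*\mu),$$ and assume $d_2$ is proper (so $d_1,d_2$ are proper, closed, convex on $\mathcal{K}$). Put $\hat\beta=\frac{\|\mathcal{A}^*\|^2}{\sigma}$, $\hat\sigma=\frac{\theta^2}{\beta}$, and for $\gamma\in(0,\infty)$ $$\hat\delta=\max\left(\frac{\gamma\hat\beta-1}{1+\gamma\hat\beta},\frac{1-\gamma\hat\sigma}{1+\gamma\hat\sigma}\right).$$ Let $\alpha\in\left(0,\frac{2}{1+\hat\delta}\right)$. Then the iteration $$z^{k+1}=\big((1-\alpha)\mathrm{Id}+\alpha R_{\gamma d_1}R_{\gamma d_2}\big)z^k$$ (equivalently, ADMM applied to minimize $f(x)+g(y)$ subject to $\mathcal{A}x+\mathcal{B}y=c$)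 converges at least with rate $|1-\alpha|+\alpha\hat\delta$, i.e. $$\|z^{k+1}-\bar z\|\le\big(|1-\alpha|+\alpha\hat\delta\big)\|z^k-\bar z\|\quad\text{for all }k\ge0,$$ where $\bar z$ is a fixed point of $R_{\gamma d_1}R_{\gamma d_2}$. Further, the algorithm parameters $\gamma\in(0,\infty)$ and $\alpha\in(0,\frac{2}{1+\hat\delta})$ that optimize (minimize) this rate bound are $\alpha=1$ and $\gamma=\frac{1}{\sqrt{\hat\beta\hat\sigma}}=\frac{\sqrt{\beta\sigma}}{\|\mathcal{A}^*\|\theta}$, and the optimized linear convergence rate bound factor is $$\frac{\sqrt{\hat\kappa}-1}{\sqrt{\hat\kappa}+1},\qquad \hat\kappa=\frac{\hat\beta}{\hat\sigma}=\frac{\|\mathcal{A}^*\|^2\beta}{\theta^2\sigma}.$$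
   Context: For a proper, closed, convex $h$ on a real Hilbert space and $\gamma>0$: $\mathrm{prox}_{\gamma h}(z)=\operatorname{argmin}_x\{\gamma h(x)+\frac12\|x-z\|^2\}$ and $R_{\gamma h}=2\,\mathrm{prox}_{\gamma h}-\mathrm{Id}$. The conjugate is $h^*(y)=\sup_x\{\langle y,x\rangle-h(x)\}$; $\mathcal{A}^*$ denotes the adjoint. $f$ is $\sigma$-strongly convex if $f-\frac{\sigma}{2}\|\cdot\|^2$ is convex, and $\beta$-smooth if it is differentiable and $\frac{\beta}{2}\|\cdot\|^2-f$ is convex. The space $\mathcal{K}$ is nonzero. ADMM (with relaxation $\alpha$ and scaled dual variable $u$) is the iteration $x^{k+1}=\operatorname{argmin}_x\{f(x)+\frac{\gamma}{2}\|\mathcal{A}x+\mathcal{B}y^k-c+u^k\|^2\}$, $x_A^{k+1}=2\alpha\mathcal{A}x^{k+1}-(1-2\alpha)(\mathcal{B}y^k-c)$, $y^{k+1}=\operatorname{argmin}_y\{g(y)+\frac{\gamma}{2}\|x_A^{k+1}+\mathcal{B}y-c+u^k\|^2\}$, $u^{k+1}=u^k+(x_A^{k+1}+\mathcal{B}y^{k+1}-c)$; it is identified with the $z$-iteration through $z^k=\gamma(u^k-\mathcal{B}y^k)$, and convergence of ADMM is understood as convergence of this sequence $z^k$.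
   Formalization: The ADMM equivalence is proved for runs from k=1 on, and at k=0 only if prox of γd_2 at z^0 equals γu^0 (it fails for arbitrary y^0,u^0); passing from the z-iteration to ADMM assumes the y-subproblems have minimizers, as otherwise ADMM is undefined. *)

(* Defs.v *)
From HB Require Import structures.
From mathcomp Require Import all_boot all_order all_algebra.
From mathcomp Require Import all_classical all_reals all_analysis.

Set Implicit Arguments.
Unset Strict Implicit.
Unset Printing Implicit Defensive.

Import Order.TTheory GRing.Theory Num.Theory.
Import numFieldNormedType.Exports.

Local Open Scope classical_set_scope.
Local Open Scope ring_scope.

(* Real Hilbert spaces: complete normed modules over [R : realType] whose norm
   is induced by an inner product. *)
HB.mixin Record CompleteNormedModule_isHilbert (R : realType) V
    of CompleteNormedModule R V := {
  inner : {dot V for (@idfun R)} ;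
  sqr_norm_inner : forall x : V, `|x| ^+ 2 = inner x x
}.

#[short(type="hilbertType")]
HB.structure Definition Hilbert (R : realType) :=
  {V of CompleteNormedModule_isHilbert R V & CompleteNormedModule R V}.

Section linear_operators.
Context {R : realType} {H K : hilbertType R}.

(* Chosen pointwise; by the Riesz representation theorem the set below is a
   singleton when [T] is bounded and linear. *)
Definition adjoint (T : H -> K) (mu : K) : H :=
  xget 0 [set y | forall x, inner (T x) mu = inner x y].

Definition op_norm (T : H -> K) : R :=
  sup [set `|T x| | x in [set x | `|x| <= 1]].

End linear_operators.

Section extended_real_functions.
Context {R : realType} {V : hilbertType R}.
Implicit Types h : V -> \bar R.

Definition proper_fun h :=
  (forall x, h x != -oo%E) /\ (exists x, (h x < +oo)%E).

Definition closed_fun h := closed [set p : V * R | (h p.1 <= p.2%:E)%E].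

(* Only used for functions avoiding -oo, so no sum is of the form oo - oo. *)
Definition convex_fun h := forall (x y : V) (t : R), 0 < t < 1 ->
  (h (t *: x + (1 - t) *: y)%R <= t%:E * h x + (1 - t)%:E * h y)%E.

Definition proper_closed_convex h :=
  [/\ proper_fun h, closed_fun h & convex_fun h].

Definition strongly_convex (sigma : R) h :=
  convex_fun (fun x => h x - (sigma / 2 * `|x| ^+ 2)%:E)%E.

Definition smooth (beta : R) h :=
  [/\ forall x, h x \is a fin_num,
      forall x, differentiable (fine \o h) x
    & convex_fun (fun x => (beta / 2 * `|x| ^+ 2)%:E - h x)%E].

Definition conjugate h (y : V) : \bar R :=
  ereal_sup [set ((inner y x)%:E - h x)%E | x in setT].

End extended_real_functions.

Definition is_argmin {R : realType} {T : Type} (F : T -> \bar R) (p : T) :=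
  forall x, (F p <= F x)%E.

Section operator_splitting.
Context {R : realType} {K : hilbertType R}.
Implicit Types h : K -> \bar R.

(* A junk value is only returned when the minimizer does not exist, which is
   excluded for [0 < gamma] and [h] proper, closed and convex. *)
Definition prox (gamma : R) h (z : K) : K :=
  xget 0 [set p |
    is_argmin (fun x => gamma%:E * h x + (2^-1 * `|x - z| ^+ 2)%:E)%E p].

Definition refl_prox (gamma : R) h (z : K) : K := 2 *: prox gamma h z - z.

Definition dr_iteration (gamma alpha : R) (h1 h2 : K -> \bar R) (z : nat -> K) :=
  forall k, z k.+1 = (1 - alpha) *: z k +
    alpha *: refl_prox gamma h1 (refl_prox gamma h2 (z k)).

End operator_splitting.

Section admm.
Context {R : realType} {H1 H2 K : hilbertType R}.
Variables (f : H1 -> \bar R) (g : H2 -> \bar R).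
Variables (A : H1 -> K) (B : H2 -> K) (c : K).

Definition dual1 (mu : K) : \bar R :=
  (conjugate f (- adjoint A mu)%R + (inner c mu)%:E)%E.

Definition dual2 (mu : K) : \bar R := conjugate g (- adjoint B mu).

Definition admm_xA (alpha : R) (x : H1) (y : H2) : K :=
  (2 * alpha) *: A x - (1 - 2 * alpha) *: (B y - c).

(* The updates are relations: any minimizer is allowed, and [x 0] plays no
   role. *)
Definition admm_iteration (gamma alpha : R)
    (x : nat -> H1) (y : nat -> H2) (u : nat -> K) := forall k,
  [/\ is_argmin (fun x' =>
        f x' + (gamma / 2 * `|A x' + B (y k) - c + u k| ^+ 2)%:E)%E (x k.+1),
      is_argmin (fun y' => g y' + (gamma / 2 *
        `|admm_xA alpha (x k.+1) (y k) + B y' - c + u k| ^+ 2)%:E)%E (y k.+1)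
    & u k.+1 = u k + (admm_xA alpha (x k.+1) (y k) + B (y k.+1) - c)].

Definition admm_z (gamma : R) (y : nat -> H2) (u : nat -> K) (k : nat) : K :=
  gamma *: (u k - B (y k)).

End admm.

Section rate.
Context {R : realType}.
Variables bhat shat : R.

Definition dhat (gamma : R) : R :=
  Num.max ((gamma * bhat - 1) / (1 + gamma * bhat))
          ((1 - gamma * shat) / (1 + gamma * shat)).

Definition admissible (gamma alpha : R) :=
  0 < gamma /\ 0 < alpha < 2 / (1 + dhat gamma).

Definition rate (gamma alpha : R) : R := `|1 - alpha| + alpha * dhat gamma.

End rate.

(* Main.v *)
Require Import Defs.
From HB Require Import structures.
From mathcomp Require Import all_boot all_order all_algebra.
From mathcomp Require Import all_classical all_reals all_analysis.
From mathcomp Require Import ring lra.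

Set Implicit Arguments.
Unset Strict Implicit.
Unset Printing Implicit Defensive.

Import Order.TTheory GRing.Theory Num.Theory.
Import numFieldNormedType.Exports.

Local Open Scope classical_set_scope.
Local Open Scope ring_scope.

(** The averaged operator contracts with factor [|1 - alpha| + alpha q] as soon
    as [R_{gamma d1} R_{gamma d2}] is [q]-Lipschitz. The reflection of the closed
    convex function [d2] is nonexpansive, so the point is that the reflection of
    [d1] is [dhat]-Lipschitz; then Banach's theorem provides the fixed point
    ([lipschitz_fixed_point]) and [averaged_contraction] the rate.

    The Lipschitz bound is obtained without conjugate calculus for strong
    convexity and smoothness. A minimizer [x] of the augmented Lagrangian
    subproblem for the input [w] exists because [f] is strongly convex
    ([strongly_convex_argmin]), and the first-order condition
    ([argmin_subgradient]) together with the equality case of the Fenchel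
    inequality shows that [p = w + gamma (A x - c)] is the proximal point
    ([admm_step_prox]), with [- A^* p] a subgradient of [f] at [x]. For two inputs,
    smoothness and strong convexity give the interpolation inequality
    [<beta dx - dq, dq - sigma dx> >= 0] between differences of points and
    gradients ([gradient_interpolation]). With [dq = - A^* dp], [dv = - A dx] and
    the bounds [theta |mu| <= |A^* mu| <= |A^*| |mu|], it becomes
    [<dv - shat dp, bhat dp - dv> >= 0] ([dual_interpolation]), the inequality for
    a [shat]-strongly convex [bhat]-smooth dual. This yields
    [|dp - gamma dv| <= dhat |dp + gamma dv|] ([reflection_contraction]), whose two
    sides are the differences of the outputs and of the inputs of the reflection.

    The same description of proximal points by subproblem minimizers identifies
    ADMM with the [z]-iteration ([dr_step_admm]).

    For the parameters, [dhat] is the maximum of an increasing and a decreasing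
    function of [gamma] that cross at [1 / sqrt (bhat shat)], and for a fixed value
    [0 <= dhat < 1] the rate is minimal exactly at [alpha = 1] ([rate_gap]). *)

(** * Inner products *)
Section inner_product.
Context {R : realType} {V : hilbertType R}.
Implicit Types (x y z : V) (t a : R).

Lemma innerC x y : inner x y = inner y x.
Proof. by rewrite hermC expr0 mul1r. Qed.

Lemma innerDl x y z : inner (x + y) z = inner x z + inner y z.
Proof. exact: linearDl. Qed.

Lemma innerDr x y z : inner z (x + y) = inner z x + inner z y.
Proof. exact: linearDr. Qed.

Lemma innerNl x z : inner (- x) z = - inner x z.
Proof. exact: linearNl. Qed.

Lemma innerNr x z : inner z (- x) = - inner z x.
Proof. exact: linearNr. Qed.

Lemma innerZl a x z : inner (a *: x) z = a * inner x z.
Proof. exact: linearZl_LR. Qed.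

Lemma innerZr a x z : inner z (a *: x) = a * inner z x.
Proof. exact: linearZr_LR. Qed.

Lemma inner0l z : inner 0 z = 0.
Proof. exact: linear0l. Qed.

Lemma inner0r z : inner z 0 = 0.
Proof. exact: linear0r. Qed.

Definition innerE :=
  (innerDl, innerDr, innerNl, innerNr, innerZl, innerZr, inner0l, inner0r).

Lemma inner_ge0 x : 0 <= inner x x.
Proof. by rewrite -sqr_norm_inner sqr_ge0. Qed.

Lemma inner_eq0 x : inner x x = 0 -> x = 0.
Proof.
by rewrite -sqr_norm_inner => /eqP; rewrite sqrf_eq0 normr_eq0 => /eqP.
Qed.

(** Testing against every vector turns an identity between vectors into one
    between real numbers, where [ring] and [field] apply. *)
Lemma inner_ext x y : (forall z, inner x z = inner y z) -> x = y.
Proof.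
move=> xy; apply/subr0_eq/inner_eq0.
by rewrite innerDl innerNl xy subrr.
Qed.

Lemma sqr_normD x y : `|x + y| ^+ 2 = `|x| ^+ 2 + 2 * inner x y + `|y| ^+ 2.
Proof. rewrite !sqr_norm_inner !innerE (innerC y x); ring. Qed.

Lemma sqr_norm_conv t x y :
  `|t *: x + (1 - t) *: y| ^+ 2 =
  t * `|x| ^+ 2 + (1 - t) * `|y| ^+ 2 - t * (1 - t) * `|x - y| ^+ 2.
Proof. rewrite !sqr_norm_inner !innerE (innerC y x); ring. Qed.

Lemma cauchy_schwarz_sqr x y : inner x y ^+ 2 <= `|x| ^+ 2 * `|y| ^+ 2.
Proof.
have [->|y0] := eqVneq y 0; first by rewrite inner0r normr0 !expr0n/= mulr0.
have yy : 0 < inner y y by rewrite -sqr_norm_inner exprn_gt0 ?normr_gt0.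
have := inner_ge0 (inner y y *: x - inner x y *: y).
rewrite !innerE (innerC y x) !sqr_norm_inner => h.
rewrite -subr_ge0 -(pmulr_rge0 _ yy); apply: le_trans h _; lra.
Qed.

Lemma cauchy_schwarz x y : inner x y <= `|x| * `|y|.
Proof.
apply: le_trans (ler_norm _) _.
rewrite -(@ler_pXn2r _ 2)// ?nnegrE ?mulr_ge0//.
by rewrite real_normK ?num_real// exprMn cauchy_schwarz_sqr.
Qed.

Lemma normr_inner x y : `|inner x y| <= `|x| * `|y|.
Proof.
by rewrite ler_norml cauchy_schwarz andbT lerNl -innerNl -(normrN x) cauchy_schwarz.
Qed.

Lemma inner_continuous y : continuous (fun x => inner x y).
Proof.
move=> x; apply/cvgrPdist_le => e e0; near=> z.
rewrite -innerNl -innerDl (le_trans (normr_inner _ _))//.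
have y1 : 0 < `|y| + 1 by rewrite ltr_pwDr.
apply: (@le_trans _ _ (`|x - z| * (`|y| + 1))).
  by rewrite ler_wpM2l// lerDl.
rewrite -ler_pdivlMr//; near: z.
by apply: cvgr_dist_le => //; rewrite divr_gt0.
Unshelve. all: by end_near. Qed.

End inner_product.

(** * Minimizers of strongly convex functions *)
Section strong_convexity.
Context {R : realType} {V : hilbertType R}.
Implicit Types (h : V -> \bar R) (q : V -> R).

(** Strong convexity with modulus [m] (plain convexity for [m = 0]), read on the
    points [(x, a)] of the epigraph: the inequality then involves real numbers
    only, and infinite values need no case distinction. *)
Definition epi_convex (m : R) h := forall (x y : V) (a b t : R), 0 < t < 1 ->
  (h x <= a%:E)%E -> (h y <= b%:E)%E ->
  (h (t *: x + (1 - t) *: y)%R <=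
     (t * a + (1 - t) * b - m / 2 * t * (1 - t) * `|x - y| ^+ 2)%:E)%E.

(** The epigraph of [gamma h + q] is the preimage of that of [h] under
    [(x, a) |-> (x, (a - q x) / gamma)]; closedness and convexity of the
    perturbed function follow from this. *)
Lemma epi_perturb (gamma : R) (e : \bar R) (b a : R) : 0 < gamma ->
  ((gamma%:E * e + b%:E <= a%:E) = (e <= ((a - b) / gamma)%:E))%E.
Proof.
move=> g0; case: e => [r| |].
- by rewrite -EFinM -EFinD !lee_fin ler_pdivlMr// mulrC lerBrDr.
- by rewrite gt0_muley ?lte_fin// addye// !leye_eq.
- by rewrite gt0_muleNy ?lte_fin// addNye !leNye.
Qed.

Lemma proper_perturb gamma h q : 0 < gamma -> proper_fun h ->
  proper_fun (fun x => (gamma%:E * h x + (q x)%:E)%E).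
Proof.
move=> g0 [hNy [x0 hx0]]; split.
  by move=> x; have := hNy x; case: (h x) => [r| |]//; rewrite gt0_muley ?lte_fin//.
by exists x0; have := hNy x0; case: (h x0) hx0 => [r| |]// _ _; rewrite ltry.
Qed.

Lemma closed_fun_continuous (q : V -> R) : continuous q ->
  closed_fun (fun x => (q x)%:E).
Proof.
move=> qc; rewrite /closed_fun.
rewrite (_ : mkset _ = (fun p : V * R => p.2 - q p.1) @^-1` [set r | 0 <= r]).
  apply: (continuous_closedP _).1 (@closed_ge R 0) => p; apply: cvgB.
    exact: cvg_snd.
  by apply: continuous_comp; [exact: cvg_fst | exact: qc].
by apply/seteqP; split=> p /=; rewrite lee_fin subr_ge0.
Qed.

Lemma closed_perturb gamma h q : 0 < gamma -> continuous q -> closed_fun h ->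
  closed_fun (fun x => (gamma%:E * h x + (q x)%:E)%E).
Proof.
move=> g0 qc hc; rewrite /closed_fun.
rewrite (_ : mkset _ = (fun p : V * R => (p.1, (p.2 - q p.1) / gamma)) @^-1`
    [set p | (h p.1 <= p.2%:E)%E]); last first.
  by apply/seteqP; split=> p /=; rewrite epi_perturb.
apply: (continuous_closedP _).1 hc => -[p a].
apply: (@cvg_pair _ _ _ _ (nbhs p) (nbhs ((a - q p) / gamma))).
  exact: cvg_fst.
apply: cvgM; last exact: cvg_cst.
apply: cvgB; first exact: cvg_snd.
by apply: continuous_comp; [exact: cvg_fst | exact: qc].
Qed.

Lemma epi_convex_perturb gamma m m' h q : 0 < gamma -> epi_convex m h ->
  (forall x y t, 0 < t < 1 -> q (t *: x + (1 - t) *: y) <=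
     t * q x + (1 - t) * q y - m' / 2 * t * (1 - t) * `|x - y| ^+ 2) ->
  epi_convex (gamma * m + m') (fun x => (gamma%:E * h x + (q x)%:E)%E).
Proof.
move=> g0 hm hq x y a b t t01; rewrite !epi_perturb// => ha hb.
apply: (le_trans (hm _ _ _ _ _ t01 ha hb)); rewrite lee_fin ler_pdivlMr//.
set D := `|x - y| ^+ 2; have := hq x y t t01; rewrite -/D => hqt.
have -> : (t * ((a - q x) / gamma) + (1 - t) * ((b - q y) / gamma) -
   m / 2 * t * (1 - t) * D) * gamma =
   t * (a - q x) + (1 - t) * (b - q y) - gamma * m / 2 * t * (1 - t) * D.
  by field; rewrite gt_eqF.
lra.
Qed.

Lemma convex_epi h : convex_fun h -> epi_convex 0 h.
Proof.
move=> hc x y a b t t01 ha hb; apply: (le_trans (hc x y t t01)).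
rewrite !mul0r subr0 [leRHS]EFinD !EFinM; case/andP: t01 => t0 t1.
by apply: leeD; rewrite lee_pmul2l// lte_fin subr_gt0.
Qed.

Lemma strongly_convex_epi sigma h : strongly_convex sigma h ->
  epi_convex sigma h.
Proof.
move=> hc x y a b t t01 ha hb.
have e0 (e : \bar R) c d : ((e - d%:E <= c%:E) = (e <= (c + d)%:E))%E.
  by rewrite EFinD leeBlDr.
have := @convex_epi _ hc x y (a - sigma / 2 * `|x| ^+ 2)
  (b - sigma / 2 * `|y| ^+ 2) t t01.
rewrite /= !e0 !subrK => /(_ ha hb) /le_trans; apply.
rewrite lee_fin sqr_norm_conv; lra.
Qed.

Lemma epi_convex_convex_fun h : (forall x, h x != -oo%E) -> epi_convex 0 h ->
  convex_fun h.
Proof.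
move=> hNy hc x y t /[dup] t01 /andP[t0 t1].
have t1' : 0 < 1 - t by rewrite subr_gt0.
have := hNy x; have := hNy y.
case hx : (h x) => [a| |]//; case hy : (h y) => [b| |]// _ _.
- have := hc x y a b t t01; rewrite hx hy !lexx => /(_ isT isT)/le_trans; apply.
  by rewrite lee_fin !mul0r subr0.
- by rewrite gt0_muley ?lte_fin// leey.
- by rewrite gt0_muley ?lte_fin// leey.
- by rewrite !gt0_muley ?lte_fin// leey.
Qed.

(** A substitute for an affine minorant that avoids Hahn-Banach. The point
    [(x0, v - 1)] lies outside the closed epigraph, so [h > v - 1] on a ball
    around [x0]. For [x] outside the ball, some point of the segment from [x0] to
    [x] lies inside, and convexity turns the bound there into a bound on the
    descent of [h] along the whole segment. *)
Lemma closed_minorant h x0 (v : R) : h x0 = v%:E -> closed_fun h ->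
  epi_convex 0 h ->
  exists2 C : R, 0 <= C & forall x a, (h x <= a%:E)%E -> v - 1 - C * `|x - x0| <= a.
Proof.
move=> hx0 hcl hcv.
have [r r0 hr] : exists2 r : R, 0 < r &
    forall y, `|y - x0| < r -> ~ (h y <= (v - 1)%:E)%E.
  have := closed_openC hcl; rewrite openE.
  have N : (~` [set p : V * R | (h p.1 <= p.2%:E)%E]) (x0, v - 1).
    by move=> /=; rewrite hx0 lee_fin; apply/negP; rewrite -ltNge gtrBl.
  move=> /(_ _ N); rewrite /interior -nbhs_ballE => -[r /= r0 hr].
  exists r => // y yx hy; apply: (hr (y, v - 1)) hy.
  by split => /=; rewrite -ball_normE /= ?subrr ?normr0// distrC.
exists (2 / r); first by rewrite divr_ge0 ?(ltW r0).
move=> x a hxa; have [xr|rx] := ltP `|x - x0| r.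
  have := hr _ xr; rewrite leNgt => /negP; rewrite negbK => va.
  have : v - 1 < a by rewrite -lte_fin; exact: lt_le_trans va hxa.
  have : 0 <= 2 / r * `|x - x0| by rewrite !mulr_ge0 ?invr_ge0 ?(ltW r0).
  lra.
set D := `|x - x0| in rx *; have D0 : 0 < D by exact: lt_le_trans rx.
pose t := r / (2 * D).
have t01 : 0 < t < 1.
  by rewrite /t divr_gt0 ?mulr_gt0//= ltr_pdivrMr ?mulr_gt0// mul1r; lra.
have yx : `|t *: x + (1 - t) *: x0 - x0| < r.
  have -> : t *: x + (1 - t) *: x0 - x0 = t *: (x - x0).
    by apply: inner_ext => z; rewrite !innerE; ring.
  rewrite normrZ gtr0_norm; last by case/andP: t01.
  have -> : t * `|x - x0| = r / 2 by rewrite /t -/D; field; rewrite gt_eqF.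
  lra.
have := hcv x x0 a v t t01 hxa; rewrite hx0 lexx => /(_ isT).
rewrite !mul0r subr0 => hy; have := hr _ yx; rewrite leNgt => /negP.
rewrite negbK => /lt_le_trans => /(_ _ hy); rewrite lte_fin => hva.
have t0 : 0 < t by case/andP: t01.
have : t * (v - a) < 1 by lra.
rewrite mulrC -ltr_pdivlMr// => hva'.
have e : 1 / t = 2 / r * D by rewrite /t; field; rewrite !gt_eqF.
lra.
Qed.

(** The quadratic gain of strong convexity beats the linear bound of
    [closed_minorant], so [h] is bounded below. The same gain, applied to
    midpoints, makes every minimizing sequence Cauchy; closedness of the epigraph
    shows that its limit attains the infimum. *)
Lemma strongly_convex_argmin (m : R) h : 0 < m -> proper_fun h -> closed_fun h ->
  epi_convex m h -> exists p, is_argmin h p.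
Proof.
move=> m0 [hNy [x0 hx0]] hcl hcv.
have hcv0 : epi_convex 0 h.
  move=> x y a b t t01 ha hb; apply: le_trans (hcv _ _ _ _ _ t01 ha hb) _.
  case/andP: t01 => t0 t1.
  by rewrite lee_fin !mul0r subr0 gerBl !mulr_ge0 ?invr_ge0 ?sqr_ge0 ?subr_ge0//; exact: ltW.
have {hx0}[v hv] : exists v, h x0 = v%:E.
  by have := hNy x0; case: (h x0) hx0 => [v| |]// _ _; exists v.
have [C C0 hC] := closed_minorant hv hcl hcv0.
pose S := [set a | exists x, (h x <= a%:E)%E].
have half01 : 0 < (2^-1 : R) < 1 by rewrite invr_gt0 ltr0n/= invf_lt1 ?ltr1n.
have Slb : has_lbound S.
  exists (v - 2 - C ^+ 2 / m) => a [x hxa].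
  have := hcv x x0 a v _ half01 hxa; rewrite hv lexx => /(_ isT) /hC.
  have -> : 2^-1 *: x + (1 - 2^-1) *: x0 - x0 = 2^-1 *: (x - x0).
    by apply: inner_ext => z; rewrite !innerE; field.
  rewrite normrZ gtr0_norm ?invr_gt0//; set D := `|x - x0|.
  have : 0 <= m * (C / m - D / 2) ^+ 2 by rewrite mulr_ge0 ?sqr_ge0 ?ltW.
  have -> : m * (C / m - D / 2) ^+ 2 = C ^+ 2 / m - C * D + m * D ^+ 2 / 4.
    by field; rewrite gt_eqF.
  lra.
have S0 : S !=set0 by exists v, x0; rewrite hv.
pose I := inf S.
have hI x : ((I%:E) <= h x)%E.
  case hx : (h x) => [r| |]; [|by rewrite leey|by have := hNy x; rewrite hx].
  by rewrite lee_fin; apply: ge_inf => //; exists x; rewrite hx.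
have /choice[u hu] : forall n, exists x, (h x <= (I + n.+1%:R^-1)%:E)%E.
  move=> n; have n0 : 0 < n.+1%:R^-1 :> R by rewrite invr_gt0.
  have [a [x hxa] aI] := inf_adherent n0 (conj S0 Slb).
  by exists x; apply: le_trans hxa _; rewrite lee_fin ltW.
have hd n k : m / 4 * `|u n - u k| ^+ 2 <= n.+1%:R^-1 + k.+1%:R^-1.
  have := hcv _ _ _ _ _ half01 (hu n) (hu k) => /(le_trans (hI _)).
  rewrite lee_fin; move: n.+1%:R^-1 k.+1%:R^-1 (`|_| ^+ 2) => a b D; lra.
have /cauchy_cvgP/cvg_ex[p up] : cauchy (u @ \oo).
  apply/cauchy_ballP => e e0; near_simpl.
  have c0 : 0 < m / 8 * e ^+ 2 by rewrite mulr_gt0 ?divr_gt0 ?exprn_gt0.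
  near=> n k => /=.
  rewrite -ball_normE /= -(@ltr_pXn2r _ 2)// ?nnegrE ?(ltW e0)//.
  have n1 : n.+1%:R^-1 < m / 8 * e ^+ 2.
    by near: n; exact: (near_infty_natSinv_lt (PosNum c0)).
  have k1 : k.+1%:R^-1 < m / 8 * e ^+ 2.
    by near: k; exact: (near_infty_natSinv_lt (PosNum c0)).
  have m4 : 0 < m / 4 by rewrite divr_gt0.
  rewrite -(ltr_pM2l m4); apply: le_lt_trans (hd n k) _.
  move: n1 k1; move: n.+1%:R^-1 k.+1%:R^-1 => a b; lra.
exists p => x; apply: le_trans (hI x).
have cvgI : (fun n => I + n.+1%:R^-1 : R) @ \oo --> I.
  rewrite -[X in _ --> X]addr0; apply: cvgD; first exact: cvg_cst.
  exact: cvg_harmonic.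
have uI : (fun n => (u n, I + n.+1%:R^-1 : R)) @ \oo --> (p, I).
  by apply: (@cvg_pair _ _ _ _ (nbhs p) (nbhs I)).
by apply: (closed_cvg _ hcl _ _ uI); apply: nearW => n; exact: hu.
Unshelve. all: by end_near. Qed.

End strong_convexity.

(** * First-order optimality conditions *)
Section first_order.
Context {R : realType}.

(** The passage to the limit [t -> 0] after dividing a directional inequality
    by [t]. *)
Lemma limit_ge0 (a b : R) : (forall t, 0 < t < 1 -> 0 <= a + t * b) -> 0 <= a.
Proof.
move=> h; rewrite leNgt; apply/negP => a0.
have D0 : 0 < - a + (`|b| + 1) by have := normr_ge0 b; lra.
have b0 := normr_ge0 b.
have := h (- a / (- a + (`|b| + 1))); rewrite divr_gt0 ?oppr_gt0// ltr_pdivrMr//.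
have -> : - a < 1 * (- a + (`|b| + 1)) by lra.
move=> /(_ isT); rewrite leNgt => /negP; apply.
have bb := ler_norm b.
have : - a / (- a + (`|b| + 1)) * b <= - a * `|b| / (- a + (`|b| + 1)).
  by rewrite mulrAC ler_pM2r ?invr_gt0// ler_pM2l// oppr_gt0.
have : - a * `|b| / (- a + (`|b| + 1)) < - a.
  by rewrite ltr_pdivrMr// ltr_pM2l ?oppr_gt0//; lra.
lra.
Qed.

Context {V K : hilbertType R}.

Lemma sqr_norm_affine_conv (L : {linear V -> K}) (b : K) (x y : V) (t : R) :
  `|L (t *: x + (1 - t) *: y) + b| ^+ 2 =
  t * `|L x + b| ^+ 2 + (1 - t) * `|L y + b| ^+ 2
    - t * (1 - t) * `|L x - L y| ^+ 2.
Proof.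
have -> : L (t *: x + (1 - t) *: y) + b =
    t *: (L x + b) + (1 - t) *: (L y + b).
  by rewrite linearD !linearZ; apply: inner_ext => z; rewrite !innerE; ring.
rewrite sqr_norm_conv; have -> // : L x + b - (L y + b) = L x - L y.
by rewrite opprD addrACA subrr addr0.
Qed.

Lemma continuous_sqr_norm_affine (k : R) (L : {linear V -> K}) (b : K) :
  continuous L -> continuous (fun x => k * `|L x + b| ^+ 2).
Proof.
move=> Lc x; apply: cvgM; first exact: cvg_cst.
have Ln : `|L y + b| @[y --> x] --> `|L x + b|.
  by apply: cvg_norm; apply: cvgD; [exact: Lc | exact: cvg_cst].
exact: (cvgM Ln Ln).
Qed.

(** Moving from [p] towards [x] by a fraction [t], convexity of [h] and
    minimality of [p] give an inequality of first order in [t]; its limit says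
    that minus the gradient of the quadratic term is a subgradient of [h] at
    [p]. The subgradient is kept as a functional of [L x - L p], so that no adjoint
    appears. *)
Lemma argmin_subgradient (h : V -> \bar R) (L : {linear V -> K}) (b : K)
    (gamma k v : R) (p : V) :
  0 < gamma -> (forall x, h x != -oo%E) -> epi_convex 0 h -> h p = v%:E ->
  is_argmin (fun x => (gamma%:E * h x + (k / 2 * `|L x + b| ^+ 2)%:E)%E) p ->
  forall x, ((v - k / gamma * inner (L p + b) (L x - L p))%:E <= h x)%E.
Proof.
move=> g0 hNy hc hp pmin x.
have := hNy x; case hx : (h x) => [a| |]// _; last exact: leey.
set d := L x - L p; rewrite lee_fin.
suff : 0 <= gamma * (a - v) + k * inner (L p + b) d.
  rewrite -(pmulr_rge0 (_ + _) (_ : 0 < gamma^-1)) ?invr_gt0//.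
  rewrite mulrDr mulKf ?gt_eqF// mulrA (mulrC _ k); lra.
apply: (limit_ge0 (b := k / 2 * `|d| ^+ 2)) => t t01.
have ht := hc x p a v t t01; rewrite hx hp !lexx in ht.
have := pmin (t *: x + (1 - t) *: p); rewrite hp => /le_trans pmint.
have : (gamma%:E * h (t *: x + (1 - t) *: p)%R <=
    (gamma * (t * a + (1 - t) * v))%:E)%E.
  rewrite [leRHS]EFinM lee_pmul2l//.
  by have := ht isT isT; rewrite !mul0r subr0.
move=> /(leeD2r (k / 2 * `|L (t *: x + (1 - t) *: p) + b| ^+ 2)%:E) /pmint.
rewrite -EFinM -!EFinD lee_fin => {pmint ht}.
have -> : L (t *: x + (1 - t) *: p) + b = (L p + b) + t *: d.
  by rewrite linearD !linearZ; apply: inner_ext => z; rewrite !innerE; ring.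
rewrite (sqr_normD (L p + b) (t *: d)) innerZr normrZ exprMn -normrX ger0_norm ?sqr_ge0// => hmin.
have /andP[t0 _] := t01; rewrite -(pmulr_rge0 _ t0); lra.
Qed.

Lemma perturbed_argmin (gamma m m' : R) (h : V -> \bar R) (q : V -> R) :
  0 < gamma -> 0 < gamma * m + m' ->
  proper_fun h -> closed_fun h -> epi_convex m h -> continuous q ->
  (forall x y t, 0 < t < 1 -> q (t *: x + (1 - t) *: y) <=
     t * q x + (1 - t) * q y - m' / 2 * t * (1 - t) * `|x - y| ^+ 2) ->
  exists p, is_argmin (fun x => (gamma%:E * h x + (q x)%:E)%E) p.
Proof.
move=> g0 m0 hp hcl hcv qc qm; apply: (strongly_convex_argmin m0).
- exact: proper_perturb.
- exact: closed_perturb.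
- exact: epi_convex_perturb.
Qed.

Lemma argmin_fin (gamma : R) (h : V -> \bar R) (q : V -> R) p : 0 < gamma ->
  proper_fun h -> is_argmin (fun x => (gamma%:E * h x + (q x)%:E)%E) p ->
  exists v, h p = v%:E.
Proof.
move=> g0 [hNy [x hx]] /(_ x); have := hNy p; have := hNy x.
case: (h p) => [v| |]//; first by exists v.
by case: (h x) hx => // r _ _ _; rewrite gt0_muley ?lte_fin// -EFinM.
Qed.

End first_order.

(** * Proximal points *)
Section proximal.
Context {R : realType} {K : hilbertType R}.
Implicit Types (d : K -> \bar R) (z p mu : K).

(** The variational characterization of [p = prox gamma d z]:
    [(z - p) / gamma] is a subgradient of [d] at [p]. *)
Definition prox_spec (gamma : R) d z p := exists2 v, d p = v%:E &
  forall mu, ((v + gamma^-1 * inner (z - p) (mu - p))%:E <= d mu)%E.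

(** Adding the quadratic term to the subgradient inequality leaves a surplus
    of half the squared distance to [p], so [p] is the only minimizer. *)
Lemma prox_spec_eq gamma d z p : 0 < gamma -> prox_spec gamma d z p ->
  prox gamma d z = p.
Proof.
move=> g0 [v dp sub].
have quad mu : ((gamma * v + 2^-1 * `|p - z| ^+ 2 + 2^-1 * `|mu - p| ^+ 2)%:E
    <= gamma%:E * d mu + (2^-1 * `|mu - z| ^+ 2)%:E)%E.
  have := sub mu; case: (d mu) => [r| _|]; last by rewrite leeNy_eq.
    2: by rewrite gt0_muley ?lte_fin// addye// leey.
  rewrite -EFinM -EFinD !lee_fin -(ler_pM2l g0) mulrDr mulVKf ?gt_eqF// => h.
  have -> : mu - z = (mu - p) + (p - z) by rewrite addrA subrK.
  rewrite (sqr_normD (mu - p)) (innerC (mu - p)) -(opprB z p) innerNl; lra.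
have pmin : is_argmin
    (fun x => gamma%:E * d x + (2^-1 * `|x - z| ^+ 2)%:E)%E p.
  move=> mu; apply: le_trans (quad mu); rewrite dp -EFinM -EFinD lee_fin.
  by rewrite lerDl mulr_ge0 ?sqr_ge0 ?invr_ge0.
rewrite /prox; case: xgetP => [p' _ p'min|/(_ p)//].
have := le_trans (quad p') (p'min p); rewrite dp -EFinM -EFinD lee_fin.
rewrite gerDl => h; apply/subr0_eq/inner_eq0/eqP; rewrite -sqr_norm_inner.
by have := sqr_ge0 `|p' - p|; rewrite eq_le => ->; rewrite andbT; lra.
Qed.

Lemma proxP gamma d z : 0 < gamma -> proper_closed_convex d ->
  prox_spec gamma d z (prox gamma d z).
Proof.
move=> g0 [dp dcl /convex_epi dcv].
have idc : continuous (idfun : {linear K -> K}) by move=> x; exact: cvg_id.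
have [p pmin] : exists p, is_argmin
    (fun x => gamma%:E * d x + (2^-1 * `|x - z| ^+ 2)%:E)%E p.
  apply: (@perturbed_argmin _ _ gamma 0 1) => //; first by rewrite mulr0 add0r.
    exact: (@continuous_sqr_norm_affine _ _ _ _ idfun).
  move=> x y t _; rewrite (@sqr_norm_affine_conv _ _ _ idfun (- z)) /=; lra.
have [v dv] := argmin_fin g0 dp pmin.
have spec : prox_spec gamma d z p.
  exists v => // mu.
  have := @argmin_subgradient _ _ _ d idfun (- z) gamma 1 v p g0 dp.1 dcv dv.
  rewrite !div1r => /(_ pmin mu) /=.
  by rewrite -(opprB z p) innerNl mulrN opprK.
by rewrite (prox_spec_eq g0 spec).
Qed.

Lemma prox_spec_monotone gamma d z z' p p' : 0 < gamma ->
  prox_spec gamma d z p -> prox_spec gamma d z' p' ->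
  0 <= inner (z - p - (z' - p')) (p - p').
Proof.
move=> g0 [v dp sub] [v' dp' sub'].
have := sub p'; have := sub' p; rewrite dp dp' !lee_fin => h' h.
have gi : 0 < gamma^-1 by rewrite invr_gt0.
rewrite -(pmulr_rge0 _ gi); move: h' h; rewrite !innerE; lra.
Qed.

(** Expanding the squares, the difference between the two sides is four times
    the monotonicity product of [prox_spec_monotone]. *)
Lemma refl_prox_nonexpansive gamma d z z' : 0 < gamma ->
  proper_closed_convex d ->
  `|refl_prox gamma d z - refl_prox gamma d z'| <= `|z - z'|.
Proof.
move=> g0 dpcc.
have mono := prox_spec_monotone g0 (proxP z g0 dpcc) (proxP z' g0 dpcc).
rewrite -(@ler_pXn2r _ 2)// ?nnegrE// /refl_prox.
move: mono; set p := prox _ _ z; set p' := prox _ _ z'.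
rewrite !sqr_norm_inner !innerE !(innerC _ p) !(innerC _ p').
rewrite (innerC z' z) (innerC p' p); lra.
Qed.

End proximal.

(** * Adjoints *)
Section adjoint_theory.
Context {R : realType} {H K : hilbertType R}.

Variable T : {linear H -> K}.
Hypothesis Tbnd : bounded_near T (nbhs (0 : H)).

(** Riesz representation: the minimizer of [|x|^2 / 2 - <T x, mu>] represents
    the functional [x |-> <T x, mu>], by its first-order condition along [z] and
    [- z]. *)
Lemma adjointP x mu : inner (T x) mu = inner x (adjoint T mu).
Proof.
suff [y hy] : exists y, forall x, inner (T x) mu = inner x y.
  by rewrite /adjoint; case: xgetP => [y' _ ->|/(_ y)//].
have Tc := bounded_linear_continuous Tbnd.
pose q x := - inner (T x) mu.
have qc : continuous q.
  move=> z; apply: cvgN.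
  by apply: (@continuous_comp _ _ _ T (fun k => inner k mu)) => //;
    [exact: Tc | exact: inner_continuous].
have idc : continuous (idfun : {linear H -> H}) by move=> z; exact: cvg_id.
have qcv : epi_convex 0 (fun z => (q z)%:E).
  move=> z z' a b t /andP[t0 t1]; rewrite !lee_fin => ha hb.
  have Tconv : T (t *: z + (1 - t) *: z') = t *: T z + (1 - t) *: T z'.
    by rewrite linearD !linearZ.
  rewrite /q Tconv !innerE.
  have := ler_wpM2l (ltW t0) ha.
  have := ler_wpM2l (_ : 0 <= 1 - t) hb; rewrite subr_ge0 ltW// => /(_ isT).
  rewrite /q; lra.
have [y ymin] : exists y, is_argmin
    (fun z => 1%:E * (q z)%:E + (1 / 2 * `|idfun z + 0| ^+ 2)%:E)%E y.
  apply: (@perturbed_argmin _ _ 1 0 1) => //.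
  - by split=> //; exists 0; exact: ltry.
  - exact: closed_fun_continuous.
  - exact: (@continuous_sqr_norm_affine _ _ _ _ idfun).
  - move=> z z' t _; rewrite (@sqr_norm_affine_conv _ _ _ idfun) /=; lra.
have sub := @argmin_subgradient _ _ _ (fun z => (q z)%:E) idfun 0 1 1 (q y) y ltr01 (fun=> isT)
  qcv erefl ymin.
have le z : inner (T z) mu <= inner y z.
  have := sub (y + z).
  by rewrite lee_fin /q (linearD T) /= addr0 divr1 mul1r (addrC y) addrK !innerE; lra.
exists y => z; apply/eqP; rewrite eq_le (innerC z) le /=.
by have := le (- z); rewrite linearN !innerE lerN2.
Qed.

Lemma adjointN mu : adjoint T (- mu) = - adjoint T mu.
Proof.
by apply: inner_ext => x; rewrite innerC -adjointP !innerE adjointP innerC.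
Qed.

Lemma adjointD mu nu : adjoint T (mu + nu) = adjoint T mu + adjoint T nu.
Proof.
by apply: inner_ext => x; rewrite innerC -adjointP !innerE !adjointP !(innerC x).
Qed.

Lemma adjointZ a mu : adjoint T (a *: mu) = a *: adjoint T mu.
Proof.
by apply: inner_ext => x; rewrite innerC -adjointP !innerE adjointP innerC.
Qed.

Lemma adjoint_bounded : exists M, forall mu, `|adjoint T mu| <= M * `|mu|.
Proof.
have [M [_ hM]] := (linear_boundedP T).1 Tbnd.
exists (`|M| + 1) => mu; set y := adjoint T mu.
have {}hM x : `|T x| <= (`|M| + 1) * `|x|.
  by apply: hM; rewrite (le_lt_trans (ler_norm M))// ltrDl.
have [->|y0] := eqVneq y 0; first by rewrite normr0 mulr_ge0// addr_ge0.
have y1 : 0 < `|y| by rewrite normr_gt0.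
rewrite -(ler_pM2r y1) -expr2 sqr_norm_inner -adjointP.
by rewrite (le_trans (cauchy_schwarz _ _))// mulrAC ler_wpM2r.
Qed.

Lemma adjoint_op_norm mu : `|adjoint T mu| <= op_norm (adjoint T) * `|mu|.
Proof.
have [->|mu0] := eqVneq mu 0.
  by rewrite normr0 mulr0 -(scale0r (0 : K)) adjointZ scale0r normr0.
have mu1 : 0 < `|mu| by rewrite normr_gt0.
have [M hM] := adjoint_bounded.
rewrite -ler_pdivrMr//; apply: ub_le_sup.
  exists (`|M|) => _ [nu /= nu1 <-]; apply: le_trans (hM nu) _.
  rewrite (le_trans (ler_wpM2r _ (ler_norm M)))//.
  by rewrite -[leRHS]mulr1 ler_wpM2l.
exists (`|mu|^-1 *: mu) => /=.
  by rewrite normrZ gtr0_norm ?invr_gt0// mulVf ?gt_eqF.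
by rewrite adjointZ normrZ gtr0_norm ?invr_gt0// mulrC.
Qed.

End adjoint_theory.

(** * The dual function and the ADMM subproblems *)
Section dual_function.
Context {R : realType} {H K : hilbertType R}.
Variables (g : H -> \bar R) (B : {linear H -> K}) (c : K).
Hypothesis Bbnd : bounded_near B (nbhs (0 : H)).
Hypothesis gproper : proper_fun g.

(** [dual1 g B c] is the supremum over the epigraph of [g] of the functions
    [mu |-> - <B x - c, mu> - b], which are affine and continuous; that is why it
    is closed and convex. *)
Lemma dual1_le mu a : (dual1 g B c mu <= a%:E)%E <->
  forall x b, (g x <= b%:E)%E -> - inner (B x - c) mu - b <= a.
Proof.
have e x b : inner (- adjoint B mu) x - b <= a - inner c mu <->
    - inner (B x - c) mu - b <= a.
  have -> : inner (- adjoint B mu) x = - inner (B x) mu.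
    by rewrite innerC innerNr -adjointP.
  by rewrite !innerE; split; lra.
rewrite /dual1 /conjugate -leeBrDr// -EFinB; split.
  move=> /ereal_supP h x b; have := gproper.1 x; case gx : (g x) => [v| |]// _.
  rewrite lee_fin => vb; apply/e; have := h _ (imageP _ (I : setT x)).
  rewrite gx -EFinB lee_fin; lra.
move=> h; apply/ereal_supP => _ [x _ <-].
have := gproper.1 x; case gx : (g x) => [v| |]// _; last by rewrite leNye.
by rewrite -EFinB lee_fin; apply/e/h; rewrite gx.
Qed.

Lemma dual1_ge y v mu : g y = v%:E ->
  ((- inner (B y - c) mu - v)%:E <= dual1 g B c mu)%E.
Proof.
move=> gy; case: leP => // lt; exfalso.
have [a ha] : exists2 a, (dual1 g B c mu <= a%:E)%E &
    a < - inner (B y - c) mu - v.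
  move: lt; case: (dual1 g B c mu) => [r| |]//; first by exists r.
  by move=> _; exists (- inner (B y - c) mu - v - 1); rewrite ?leNye ?gtrBl.
by rewrite ltNge; move/dual1_le : ha => ->//; rewrite gy.
Qed.

Lemma dual1_neqNy mu : dual1 g B c mu != -oo%E.
Proof.
have [y hy] := gproper.2; have := gproper.1 y.
case gy : (g y) hy => [v| |]// _ _; rewrite -ltNye.
exact: lt_le_trans (ltNyr _) (dual1_ge mu gy).
Qed.

Lemma dual1_closed : closed_fun (dual1 g B c).
Proof.
rewrite /closed_fun (_ : mkset _ = \bigcap_(i in [set i : H * R | (g i.1 <= i.2%:E)%E])
   [set p : K * R | (- inner (B i.1 - c) p.1 - i.2 <= p.2)]); last first.
  apply/seteqP; split=> [[mu a]/= /dual1_le h [x b]/=|[mu a]/= h]; first exact: h.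
  by apply/dual1_le => x b; exact: (h (x, b)).
apply: closed_bigI => -[x b] _ /=.
have -> : [set p : K * R | - inner (B x - c) p.1 - b <= p.2] =
   [set p : K * R | ((- inner p.1 (B x - c) - b)%:E <= p.2%:E)%E].
  by apply/seteqP; split=> p /=; rewrite lee_fin innerC.
apply: (@closed_fun_continuous _ _ (fun mu => - inner mu (B x - c) - b)) => mu.
by apply: cvgB; [apply: cvgN; exact: inner_continuous | exact: cvg_cst].
Qed.

Lemma dual1_convex : convex_fun (dual1 g B c).
Proof.
apply: epi_convex_convex_fun; first exact: dual1_neqNy.
move=> mu nu a b t /andP[t0 t1] /dual1_le ha /dual1_le hb; apply/dual1_le => x r gr.
have := ler_wpM2l (ltW t0) (ha x r gr).
have := ler_wpM2l (_ : 0 <= 1 - t) (hb x r gr).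
rewrite subr_ge0 ltW// => /(_ isT); rewrite !innerE; lra.
Qed.

(** When [- B^* p] is a subgradient of [g] at [y], the supremum defining the
    dual function at [p] is attained at [y]. Hence [- (B y - c)] is a subgradient
    of the dual function at [p], and [p] is the proximal point of
    [p - gamma (B y - c)]. *)
Lemma fenchel_prox_spec gamma y v p : 0 < gamma -> g y = v%:E ->
  (forall x, ((v - inner p (B x - B y))%:E <= g x)%E) ->
  prox_spec gamma (dual1 g B c) (p - gamma *: (B y - c)) p.
Proof.
move=> g0 gy sub; exists (- inner (B y - c) p - v).
  apply/eqP; rewrite eq_le dual1_ge// andbT; apply/dual1_le => x b /(le_trans (sub x)).
  rewrite lee_fin !innerE !(innerC p); lra.
move=> mu; apply: le_trans (dual1_ge mu gy); rewrite lee_fin.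
have -> : p - gamma *: (B y - c) - p = - (gamma *: (B y - c)).
  by apply: inner_ext => z; rewrite !innerE; ring.
rewrite innerNl innerZl mulrN mulKf ?gt_eqF// !innerE; lra.
Qed.

Lemma admm_step_subgradient gamma y v w : 0 < gamma -> epi_convex 0 g ->
  g y = v%:E ->
  is_argmin (fun x =>
    g x + (gamma / 2 * `|B x - c + gamma^-1 *: w| ^+ 2)%:E)%E y ->
  forall x, ((v - inner (w + gamma *: (B y - c)) (B x - B y))%:E <= g x)%E.
Proof.
move=> g0 gcv gy ymin x.
have ymin' : is_argmin (fun x => 1%:E * g x +
    (gamma / 2 * `|B x + (- c + gamma^-1 *: w)| ^+ 2)%:E)%E y.
  by move=> z; have := ymin z; rewrite !mul1e !addrA.
have := argmin_subgradient ltr01 gproper.1 gcv gy ymin' x.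
rewrite divr1 -innerZl; congr ((v - inner _ _)%:E <= _)%E.
apply: inner_ext => z; rewrite !innerE; field; by rewrite gt_eqF.
Qed.

(** Minimizing the augmented Lagrangian in the primal variable evaluates the
    proximal map of the dual function. *)
Lemma admm_step_prox gamma y w : 0 < gamma -> epi_convex 0 g ->
  is_argmin (fun x =>
    g x + (gamma / 2 * `|B x - c + gamma^-1 *: w| ^+ 2)%:E)%E y ->
  prox gamma (dual1 g B c) w = w + gamma *: (B y - c).
Proof.
move=> g0 gcv ymin; have [v gy] : exists v, g y = v%:E.
  apply: (@argmin_fin _ _ 1 g
    (fun x => gamma / 2 * `|B x - c + gamma^-1 *: w| ^+ 2)) => // x.
  by rewrite !mul1e.
apply: prox_spec_eq => //.
have := fenchel_prox_spec g0 gy (admm_step_subgradient g0 gcv gy ymin).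
by rewrite addrK.
Qed.

End dual_function.

(** * Interpolation inequality for smooth strongly convex functions *)
Section interpolation.
Context {R : realType}.

(** The optimal choice is [t = 1 / L]; for [L = 0] the linear growth in [t]
    forces [G = 0]. *)
Lemma quadratic_family_le (G D L : R) : 0 <= G -> 0 <= L ->
  (forall t, 2 * t * G - L * t ^+ 2 * G <= D) -> G <= L * D.
Proof.
move=> G0 L0 h.
have D0 : 0 <= D by have := h 0; lra.
have [L1|L1] := eqVneq L 0.
  rewrite L1 mul0r leNgt; apply/negP => G1; have := h ((D + 1) / (2 * G)).
  have -> : 2 * ((D + 1) / (2 * G)) * G = D + 1 by field; rewrite gt_eqF.
  by rewrite L1; lra.
have {}L0 : 0 < L by rewrite lt_neqAle eq_sym L1.
have := h L^-1.
have -> : 2 * L^-1 * G - L * L^-1 ^+ 2 * G = L^-1 * G by field; rewrite gt_eqF.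
by rewrite ler_pdivrMl.
Qed.

Context {H : hilbertType R}.
Variables (f : H -> \bar R) (sigma beta : R).
Hypotheses (fsmooth : smooth beta f) (fsc : strongly_convex sigma f).

Definition subgradient (x q : H) :=
  forall x', ((fine (f x) + inner q (x' - x))%:E <= f x')%E.

Let fE x : f x = (fine (f x))%:E.
Proof. by rewrite fineK//; case: fsmooth. Qed.

(** Along the segment from [x] to [x'], the subgradient bound from below and
    strong convexity from above differ by a term of order [t]. *)
Lemma strong_lower_bound x q x' : subgradient x q ->
  fine (f x) + inner q (x' - x) + sigma / 2 * `|x' - x| ^+ 2 <= fine (f x').
Proof.
move=> sub; rewrite -subr_ge0.
apply: (limit_ge0 (b := sigma / 2 * `|x' - x| ^+ 2)) => t t01.
have := strongly_convex_epi fsc t01 (a := fine (f x')) (b := fine (f x)) (x := x')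
  (y := x).
rewrite -!fE !lexx => /(_ isT isT) /(le_trans (sub _)); rewrite lee_fin.
have -> : t *: x' + (1 - t) *: x - x = t *: (x' - x).
  by apply: inner_ext => z; rewrite !innerE; ring.
case/andP: t01 => t0 _; rewrite innerZr => ht; rewrite -(pmulr_rge0 _ t0); lra.
Qed.

(** Convexity of [beta / 2 |.|^2 - f] is applied with [x] written as a convex
    combination of [x'] and of a point [y] slightly behind [x], where the
    subgradient inequality bounds [f] from below; [y] then tends to [x]. *)
Lemma smooth_upper_bound x q x' : subgradient x q ->
  fine (f x') <= fine (f x) + inner q (x' - x) + beta / 2 * `|x' - x| ^+ 2.
Proof.
move=> sub; set d := x' - x.
rewrite -subr_ge0.
apply: (limit_ge0 (b := fine (f x') - fine (f x) - inner q d)) => t t01.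
have /andP[t0 t1] := t01; have s0 : 0 < 1 - t by rewrite subr_gt0.
pose y := x - (t / (1 - t)) *: d.
have xE : t *: x' + (1 - t) *: y = x.
  apply: inner_ext => z; rewrite /y /d !innerE; field.
  by rewrite gt_eqF.
have x'y : x' - y = (1 - t)^-1 *: d.
  apply: inner_ext => z; rewrite /y /d !innerE; field.
  by rewrite gt_eqF.
have [_ _ fs] := fsmooth.
have := @convex_epi _ _ _ fs x' y (beta / 2 * `|x'| ^+ 2 - fine (f x'))
  (beta / 2 * `|y| ^+ 2 - fine (f y)) t t01.
have e3 z : ((beta / 2 * `|z| ^+ 2)%:E - f z =
    (beta / 2 * `|z| ^+ 2 - fine (f z))%:E)%E by rewrite EFinB -fE.
rewrite /= !xE !e3 !lexx lee_fin => /(_ isT isT) hc.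
have := sub y; rewrite [leRHS]fE lee_fin => suby.
have := sqr_norm_conv t x' y; rewrite xE x'y normrZ exprMn => xn.
have e1 : `|(1 - t)^-1| ^+ 2 = (1 - t)^-1 ^+ 2 by rewrite real_normK ?num_real.
have yx : inner q (y - x) = - (t / (1 - t)) * inner q d.
  by rewrite /y addrAC subrr add0r innerNr innerZr mulNr.
rewrite yx in suby; rewrite e1 in xn.
have e2 (z : R) : t * (1 - t) * ((1 - t)^-1 ^+ 2 * z) = t / (1 - t) * z.
  by field; rewrite gt_eqF.
rewrite {}e2 in xn; set D := `|d| ^+ 2 in xn *; set I := inner q d in suby *.
have := ler_wpM2l (ltW s0) suby.
have -> : (1 - t) * (fine (f x) + - (t / (1 - t)) * I) =
  (1 - t) * fine (f x) - t * I by field; rewrite gt_eqF.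
move=> suby'.
have hx : t * fine (f x') <= t * fine (f x) + t * I + beta / 2 * (t / (1 - t) * D).
  have := congr1 (fun r => beta / 2 * r) xn; rewrite /= !mulrDr; lra.
have : 0 <= (1 - t) * (t * fine (f x) + t * I + beta / 2 * (t / (1 - t) * D)
    - t * fine (f x')) by rewrite mulr_ge0 ?subr_ge0// ltW.
have -> : (1 - t) * (t * fine (f x) + t * I + beta / 2 * (t / (1 - t) * D)
    - t * fine (f x')) = t * ((1 - t) * (fine (f x) + I - fine (f x')) +
   beta / 2 * D) by field; rewrite gt_eqF.
rewrite pmulr_rge0//; lra.
Qed.

(** Cocoercivity of the gradient of [f - sigma / 2 |.|^2], which is convex and
    [(beta - sigma)]-smooth: the lower bound at one point and the upper bound at
    the other are compared at a point displaced by [t] times the difference [G] of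
    the gradients, then the two symmetric inequalities are added. *)
Lemma gradient_interpolation x y q r : sigma <= beta ->
  subgradient x q -> subgradient y r ->
  0 <= inner (beta *: (x - y) - (q - r)) ((q - r) - sigma *: (x - y)).
Proof.
move=> sb subx suby.
have [dx dxE] : exists dx, dx = x - y by eexists.
have [G GE] : exists G, G = q - r - sigma *: dx by eexists.
rewrite -dxE -GE.
have key t : 2 * t * inner G G - (beta - sigma) * t ^+ 2 * inner G G <= inner G dx.
  have step a b a' b' s : subgradient a a' -> subgradient b b' ->
      fine (f a) + inner a' (b + s *: G - a) + sigma / 2 * `|b + s *: G - a| ^+ 2 <=
      fine (f b) + s * inner b' G + beta / 2 * s ^+ 2 * inner G G.
    move=> sa sb'; apply: le_trans (strong_lower_bound _ sa) _.
    apply: le_trans (smooth_upper_bound _ sb') _.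
    rewrite (addrC b) addrK innerZr sqr_norm_inner !innerE; lra.
  have h1 := step x y q r t subx suby.
  have h2 := step y x r q (- t) suby subx.
  have := lerD h1 h2; rewrite !sqr_norm_inner.
  have Gdx : inner G dx = inner q dx - inner r dx - sigma * inner dx dx.
    by rewrite GE !innerE.
  have GG : inner G G = inner q G - inner r G - sigma * inner G dx.
    by rewrite {1}GE !innerE (innerC dx).
  have e1 : y + t *: G - x = t *: G - dx.
    by apply: inner_ext => z; rewrite dxE !innerE; ring.
  have e2 : x + - t *: G - y = dx - t *: G.
    by apply: inner_ext => z; rewrite dxE !innerE; ring.
  rewrite e1 e2 !innerE (innerC dx G); move: GG Gdx.
  move: (inner q dx) (inner r dx) (inner G G) (inner q G) (inner r G) (inner G dx)
    (inner dx dx) => *; nra.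
have := quadratic_family_le (inner_ge0 G) (_ : 0 <= beta - sigma) key.
rewrite subr_ge0 sb => /(_ isT).
have -> : beta *: dx - (q - r) = (beta - sigma) *: dx - G.
  by apply: inner_ext => z; rewrite GE !innerE; ring.
rewrite !innerE (innerC dx); lra.
Qed.

End interpolation.

(** * Interpolation inequality for the dual function *)
Section dual_interpolation.
Context {R : realType} {H K : hilbertType R}.
Variables (A : {linear H -> K}) (sigma beta theta n : R).
Hypotheses (Abnd : bounded_near A (nbhs (0 : H))).
Hypotheses (sigma0 : 0 < sigma) (sb : sigma <= beta) (theta0 : 0 < theta).
Hypothesis theta_le : forall mu, theta * `|mu| <= `|adjoint A mu|.
Hypothesis le_n : forall mu, `|adjoint A mu| <= n * `|mu|.

(** Put [r = x + A^* p / beta] and [rho = - <r, A^* p>]. By hypothesis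
    [|r|^2 <= (1/sigma - 1/beta) rho], so for [rho > 0] the symmetric
    operator [Id / beta + r r^T / rho] lies between [1/beta] and [1/sigma] and sends
    [- A^* p] to [x]. Conjugating it by [A] gives a symmetric operator that sends
    [p] to [- A x] and lies between [theta^2/beta] and [n^2/sigma], by the bounds on
    [A^*]; such a pair satisfies the conclusion. The proof makes this computation
    with quadratic forms only: [w] is the image of [p] under the operator minus
    its lower bound, and [key] is the Cauchy-Schwarz inequality for the
    corresponding positive form, evaluated at [p - t w]. *)
Lemma dual_interpolation x p : theta ^+ 2 / beta <= n ^+ 2 / sigma ->
  0 <= inner (beta *: x - - adjoint A p) (- adjoint A p - sigma *: x) ->
  0 <= inner (- A x - (theta ^+ 2 / beta) *: p)
             ((n ^+ 2 / sigma) *: p - - A x).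
Proof.
move=> s_le_b hyp.
have beta0 : 0 < beta by exact: lt_le_trans sb.
set s := theta ^+ 2 / beta; set b := n ^+ 2 / sigma.
pose k := sigma^-1 - beta^-1.
have k0 : 0 <= k by rewrite subr_ge0 lef_pV2 ?posrE.
have [P PE] : exists P, P = adjoint A p by eexists.
have [r rE] : exists r, r = x + beta^-1 *: P by eexists.
have xE : x = r - beta^-1 *: P by rewrite rE addrK.
have [w wE] : exists w, w = - A x - s *: p by eexists.
have [W WE] : exists W, W = adjoint A w by eexists.
have {}hyp : inner r r <= k * - inner r P.
  have si : 0 < (sigma * beta)^-1 by rewrite invr_gt0 mulr_gt0.
  move: hyp; rewrite -PE xE -(pmulr_rge0 _ si).
  have -> : (sigma * beta)^-1 * inner (beta *: (r - beta^-1 *: P) - - P)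
      (- P - sigma *: (r - beta^-1 *: P)) = k * - inner r P - inner r r.
    by rewrite !innerE (innerC P r) /k; field; rewrite !gt_eqF.
  by rewrite subr_ge0.
(* an upper bound for the rank-one form at [p - t *: w], free of the division
   by [rho], which may vanish *)
have rk t : 0 <= - inner r P + 2 * t * inner r W + t ^+ 2 * k * inner W W.
  have [k1|k1] := eqVneq k 0.
    have r0 : r = 0.
      apply/inner_eq0/eqP; rewrite eq_le inner_ge0 andbT.
      by rewrite (le_trans hyp)// k1 mul0r.
    by rewrite r0 !inner0l k1; lra.
  have k2 : 0 < k by rewrite lt_neqAle eq_sym k1.
  rewrite -(pmulr_rge0 _ k2).
  have := inner_ge0 (r + (t * k) *: W); rewrite !innerE (innerC W r); lra.
have adjA y z : inner (A y) z = inner y (adjoint A z) by exact: adjointP.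
have wy y : inner w y = beta^-1 * inner P (adjoint A y) - inner r (adjoint A y)
    - s * inner p y.
  rewrite wE !innerE adjA xE !innerE; ring.
have wp : inner w p = beta^-1 * inner P P - inner r P - s * inner p p.
  by rewrite wy -PE.
have ww : inner w w = beta^-1 * inner P W - inner r W - s * inner p w.
  by rewrite {1}wy -WE.
have WW : inner W W <= n ^+ 2 * inner w w.
  rewrite -!sqr_norm_inner -exprMn ler_pXn2r ?nnegrE//; first by rewrite WE.
  by rewrite (le_trans _ (le_n w)).
have key t : 2 * t * inner w w - (b - s) * t ^+ 2 * inner w w <= inner w p.
  have th : theta ^+ 2 * inner (p - t *: w) (p - t *: w) <=
      inner (P - t *: W) (P - t *: W).
    rewrite -!sqr_norm_inner -exprMn ler_pXn2r ?nnegrE ?mulr_ge0// ?(ltW theta0)//.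
    rewrite (le_trans (theta_le _))// PE WE adjointD// adjointN// adjointZ//.
  have bi0 : 0 < beta^-1 by rewrite invr_gt0.
  have {}th := ler_wpM2l (ltW bi0) th.
  have si0 : 0 < sigma^-1 by rewrite invr_gt0.
  have := ler_wpM2l (mulr_ge0 (sqr_ge0 t) (ltW si0)) WW.
  have := rk t; move: th.
  have -> : beta^-1 * (theta ^+ 2 * inner (p - t *: w) (p - t *: w)) =
     s * (inner p p - 2 * t * inner p w + t ^+ 2 * inner w w).
    by rewrite !innerE (innerC w p) /s; ring.
  rewrite !innerE (innerC W P) /k wp.
  have -> : t ^+ 2 / sigma * (n ^+ 2 * inner w w) = t ^+ 2 * (b * inner w w).
    by rewrite /b; ring.
  move: ww; move: (inner P P) (inner P W) (inner W W) (inner w w) (inner p w)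
     (inner p p) (inner r W) (inner r P) => PP PW WW' w' pw pp rW rP e.
  have : 2 * t * w' = 2 * t * (beta^-1 * PW - rW - s * pw) by rewrite {1}e.
  lra.
have := quadratic_family_le (inner_ge0 w) (_ : 0 <= b - s) key.
rewrite subr_ge0 s_le_b => /(_ isT).
have -> : b *: p - - A x = (b - s) *: p - w.
  by apply: inner_ext => z; rewrite wE !innerE; ring.
rewrite -wE !innerE; lra.
Qed.

End dual_interpolation.

(** * Contraction factor of the reflection *)
Section contraction.
Context {R : realType}.
Variables bhat shat : R.
Hypotheses (s0 : 0 < shat) (sb : shat <= bhat).

Let b0 : 0 < bhat. Proof. exact: lt_le_trans sb. Qed.

Lemma dhat_ge0_lt1 gamma : 0 < gamma -> 0 <= dhat bhat shat gamma < 1.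
Proof.
move=> g0; have gs := mulr_gt0 g0 s0; have gb := mulr_gt0 g0 b0.
have g1 : 0 < 1 + gamma * bhat by lra.
have g2 : 0 < 1 + gamma * shat by lra.
rewrite /dhat gt_max !ltr_pdivrMr// le_max.
have -> : gamma * bhat - 1 < 1 * (1 + gamma * bhat) by lra.
have -> : 1 - gamma * shat < 1 * (1 + gamma * shat) by lra.
rewrite !andbT; have [gb1|gb1] := leP 1 (gamma * bhat).
  by rewrite divr_ge0 ?subr_ge0// ltW.
have : gamma * shat <= gamma * bhat by rewrite ler_pM2l.
move=> sb'; apply/orP; right; rewrite divr_ge0 ?(ltW g2)//; lra.
Qed.

(** The claim in terms of [X = |p|^2], [Y = <p, v>], [Z = |v|^2]. The two
    arguments of the maximum defining [dhat] cross at [gamma^2 bhat shat = 1]; on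
    each side of it the relevant one is certified by a nonnegative combination of
    the interpolation inequality and of one of the bounds [Y <= bhat X],
    [shat X <= Y]. *)
Lemma dhat_quadratic gamma X Y Z : 0 < gamma ->
  0 <= (bhat + shat) * Y - bhat * shat * X - Z ->
  0 <= Y - shat * X -> 0 <= bhat * X - Y -> 0 <= X + 2 * gamma * Y + gamma ^+ 2 * Z ->
  X - 2 * gamma * Y + gamma ^+ 2 * Z <=
    dhat bhat shat gamma ^+ 2 * (X + 2 * gamma * Y + gamma ^+ 2 * Z).
Proof.
move=> g0 hI hs hb hS; have gs := mulr_gt0 g0 s0; have gb := mulr_gt0 g0 b0.
have gsb : gamma * shat <= gamma * bhat by rewrite ler_pM2l.
have sqr_bound (u : R) d : 0 <= u / d -> 0 < d -> u / d <= dhat bhat shat gamma ->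
    d ^+ 2 * (X - 2 * gamma * Y + gamma ^+ 2 * Z) <=
      u ^+ 2 * (X + 2 * gamma * Y + gamma ^+ 2 * Z) ->
    X - 2 * gamma * Y + gamma ^+ 2 * Z <=
      dhat bhat shat gamma ^+ 2 * (X + 2 * gamma * Y + gamma ^+ 2 * Z).
  move=> ud0 d0 ud h; apply: (@le_trans _ _ ((u / d) ^+ 2 *
      (X + 2 * gamma * Y + gamma ^+ 2 * Z))).
    by rewrite expr_div_n [leRHS]mulrAC ler_pdivlMr ?exprn_gt0// [leLHS]mulrC.
  by rewrite ler_wpM2r// ler_pXn2r// nnegrE// (le_trans ud0).
have [le1|le1] := leP 1 (gamma ^+ 2 * bhat * shat).
- have gb1 : 1 <= gamma * bhat.
    rewrite leNgt; apply/negP => lt1.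
    have : gamma * bhat * (gamma * shat) < 1 by nra.
    lra.
  apply: (@sqr_bound (gamma * bhat - 1) (1 + gamma * bhat)); [|lra|by rewrite le_max lexx|].
    by apply: divr_ge0; lra.
  have h1 := mulr_ge0 (ltW (mulr_gt0 g0 gb)) hI.
  have h2 : 0 <= (gamma ^+ 2 * bhat * shat - 1) * (bhat * X - Y).
    by apply: mulr_ge0 => //; rewrite subr_ge0.
  have := mulr_ge0 (ltW g0) (addr_ge0 h1 h2); lra.
- have gs1 : gamma * shat <= 1.
    rewrite leNgt; apply/negP => lt1.
    have : 1 < gamma * bhat * (gamma * shat) by nra.
    lra.
  apply: (@sqr_bound (1 - gamma * shat) (1 + gamma * shat));
    [|lra|by rewrite le_max lexx orbT|].
    by apply: divr_ge0; lra.
  have h1 := mulr_ge0 (ltW (mulr_gt0 g0 gs)) hI.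
  have h2 : 0 <= (1 - gamma ^+ 2 * bhat * shat) * (Y - shat * X).
    by apply: mulr_ge0 => //; rewrite subr_ge0 ltW.
  have := mulr_ge0 (ltW g0) (addr_ge0 h1 h2); lra.
Qed.

Context {K : hilbertType R}.

(** Since [|w|^2 <= e <w, p>]; for [e = 0] the vector [w] vanishes. *)
Lemma inner_ge0_of_sub (e : R) (p w : K) : 0 <= e ->
  0 <= inner w (e *: p - w) -> 0 <= inner w p.
Proof.
move=> e0; rewrite !innerE subr_ge0 => ww.
have [e1|e1] := eqVneq e 0.
  suff -> : w = 0 by rewrite inner0l.
  by apply/inner_eq0/eqP; rewrite eq_le inner_ge0 andbT (le_trans ww)// e1 mul0r.
have {}e0 : 0 < e by rewrite lt_neqAle eq_sym e1.
by rewrite -(pmulr_rge0 _ e0) (le_trans (inner_ge0 w)).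
Qed.

(** If [z = p + gamma v] with [v] a subgradient at [p = prox z], the reflection
    of [z] is [p - gamma v]; the lemma is applied to differences of such pairs. *)
Lemma reflection_contraction gamma (p v : K) : 0 < gamma ->
  0 <= inner (v - shat *: p) (bhat *: p - v) ->
  `|p - gamma *: v| <= dhat bhat shat gamma * `|p + gamma *: v|.
Proof.
move=> g0 hyp.
have /andP[d0 _] := dhat_ge0_lt1 g0.
have E0 : 0 <= bhat - shat by rewrite subr_ge0.
have hs : 0 <= inner p v - shat * inner p p.
  have := inner_ge0_of_sub E0 (p := p) (w := v - shat *: p).
  have -> : (bhat - shat) *: p - (v - shat *: p) = bhat *: p - v.
    by apply: inner_ext => z; rewrite !innerE; ring.
  by move=> /(_ hyp); rewrite !innerE (innerC v p).
have hb : 0 <= bhat * inner p p - inner p v.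
  have := inner_ge0_of_sub E0 (p := p) (w := bhat *: p - v).
  have -> : (bhat - shat) *: p - (bhat *: p - v) = v - shat *: p.
    by apply: inner_ext => z; rewrite !innerE; ring.
  by rewrite (innerC _ (v - _)) => /(_ hyp); rewrite !innerE (innerC v p).
rewrite -(@ler_pXn2r _ 2)// ?nnegrE ?mulr_ge0// exprMn.
have := @dhat_quadratic gamma (inner p p) (inner p v) (inner v v) g0.
have -> : inner p p - 2 * gamma * inner p v + gamma ^+ 2 * inner v v =
    `|p - gamma *: v| ^+ 2.
  by rewrite sqr_norm_inner !innerE (innerC v p); ring.
have -> : inner p p + 2 * gamma * inner p v + gamma ^+ 2 * inner v v =
    `|p + gamma *: v| ^+ 2.
  by rewrite sqr_norm_inner !innerE (innerC v p); ring.
apply => //.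
move: hyp; rewrite !innerE (innerC v p); lra.
Qed.

End contraction.

(** * Reflected proximal map of the dual function *)
Section dual_reflection.
Context {R : realType} {H K : hilbertType R}.
Variables (f : H -> \bar R) (A : {linear H -> K}) (c : K).
Variables (sigma beta theta gamma : R).
Hypotheses (fpcc : proper_closed_convex f).
Hypotheses (Abnd : bounded_near A (nbhs (0 : H))).
Hypotheses (fsc : strongly_convex sigma f) (sigma0 : 0 < sigma).
Hypothesis gamma0 : 0 < gamma.

Lemma admm_step_exists (w : K) : exists x, is_argmin (fun x' =>
  f x' + (gamma / 2 * `|A x' - c + gamma^-1 *: w| ^+ 2)%:E)%E x.
Proof.
have [fp fcl _] := fpcc.
have [||x xmin] := @perturbed_argmin _ H 1 sigma 0 f
    (fun x => gamma / 2 * `|A x + (- c + gamma^-1 *: w)| ^+ 2) ltr01 _ fp fcl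
    (strongly_convex_epi fsc)
    (@continuous_sqr_norm_affine _ _ _ _ A _ (bounded_linear_continuous Abnd)).
- by rewrite mul1r addr0.
- move=> x y t /andP[t0 t1]; rewrite sqr_norm_affine_conv.
  have : 0 <= gamma / 2 * (t * (1 - t) * `|A x - A y| ^+ 2).
    by rewrite !mulr_ge0 ?invr_ge0 ?subr_ge0 ?sqr_ge0// ltW.
  lra.
by exists x => x'; have := xmin x'; rewrite !mul1e !addrA.
Qed.

Hypotheses (fsmooth : smooth beta f) (sb : sigma <= beta) (theta0 : 0 < theta).
Hypothesis theta_le : forall mu, theta * `|mu| <= `|adjoint A mu|.
Let n := op_norm (adjoint A).
Let bhat := n ^+ 2 / sigma.
Let shat := theta ^+ 2 / beta.
Hypothesis s_le_b : shat <= bhat.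

(** The proximal points [p], [p'] come from minimizers [x], [x'] of the primal
    subproblems, at which [- A^* p], [- A^* p'] are subgradients of [f]. The
    interpolation inequality for [f] at these points transfers to the dual. *)
Lemma refl_prox_dual1_contraction w w' :
  `|refl_prox gamma (dual1 f A c) w - refl_prox gamma (dual1 f A c) w'| <=
  dhat bhat shat gamma * `|w - w'|.
Proof.
have [fp _ /convex_epi fcv] := fpcc.
have fE x : f x = (fine (f x))%:E by rewrite fineK//; case: fsmooth.
have [x xmin] := admm_step_exists w.
have [x' x'min] := admm_step_exists w'.
have grad v y p : is_argmin (fun x' =>
      f x' + (gamma / 2 * `|A x' - c + gamma^-1 *: v| ^+ 2)%:E)%E y ->
    p = v + gamma *: (A y - c) -> subgradient f y (- adjoint A p).
  move=> ymin -> z; have := admm_step_subgradient fp gamma0 fcv (fE y) ymin z.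
  rewrite innerNl (innerC (adjoint _ _)) -(adjointP Abnd) (linearB A).
  by rewrite (innerC (v + _)).
rewrite /refl_prox !(admm_step_prox Abnd fp gamma0 fcv xmin).
rewrite !(admm_step_prox Abnd fp gamma0 fcv x'min).
have [p pE] : exists p, p = w + gamma *: (A x - c) by eexists.
have [p' p'E] : exists p', p' = w' + gamma *: (A x' - c) by eexists.
have := gradient_interpolation fsmooth fsc sb (grad _ _ _ xmin pE)
  (grad _ _ _ x'min p'E).
have -> : - adjoint A p - - adjoint A p' = - adjoint A (p - p').
  by rewrite adjointD// adjointN// opprD.
move=> /(dual_interpolation Abnd sigma0 sb theta0 theta_le
  (adjoint_op_norm Abnd) s_le_b).
have beta0 := lt_le_trans sigma0 sb.
have shat0 : 0 < shat by rewrite divr_gt0// exprn_gt0.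
move=> /(reflection_contraction shat0 s_le_b gamma0).
have -> : p - p' - gamma *: - A (x - x') =
    2 *: (w + gamma *: (A x - c)) - w - (2 *: (w' + gamma *: (A x' - c)) - w').
  by apply: inner_ext => z; rewrite (linearB A) pE p'E !innerE; ring.
have -> // : p - p' + gamma *: - A (x - x') = w - w'.
by apply: inner_ext => z; rewrite (linearB A) pE p'E !innerE; ring.
Qed.

Lemma dual1_proper_closed_convex : proper_closed_convex (dual1 f A c).
Proof.
have [fp _ /convex_epi fcv] := fpcc.
split; [split|exact: dual1_closed|exact: dual1_convex].
  exact: dual1_neqNy.
have [x xmin] := admm_step_exists 0.
have [v fx] : exists v, f x = v%:E.
  apply: (@argmin_fin _ _ 1 f
    (fun x => gamma / 2 * `|A x - c + gamma^-1 *: 0| ^+ 2)) => // y.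
  by rewrite !mul1e.
have [v' dv _] := fenchel_prox_spec c Abnd fp gamma0 fx
  (admm_step_subgradient fp gamma0 fcv fx xmin).
by exists (0 + gamma *: (A x - c)); rewrite dv ltry.
Qed.

End dual_reflection.

(** * Optimization of the rate bound *)
Section rate_theory.
Context {R : realType}.
Variables bhat shat : R.
Hypotheses (s0 : 0 < shat) (sb : shat <= bhat).

Let b0 : 0 < bhat. Proof. exact: lt_le_trans sb. Qed.

(** For [alpha <= 1] the rate is [1 - alpha (1 - dhat)]; for [alpha > 1] it is
    [alpha (1 + dhat) - 1], where the upper bound on [alpha] enters. *)
Lemma rate_ge0_lt1 gamma alpha : admissible bhat shat gamma alpha ->
  0 <= rate bhat shat gamma alpha < 1.
Proof.
move=> [g0 /andP[a0]]; have /andP[d0 d1] := dhat_ge0_lt1 s0 sb g0.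
rewrite /rate; move: (dhat _ _ _) d0 d1 => d d0 d1.
rewrite ltr_pdivlMr; last by rewrite ltr_wpDr.
move=> ad; rewrite addr_ge0 ?mulr_ge0 ?(ltW a0)//=.
have [a1|a1] := ger0P (1 - alpha); last by lra.
have : 0 < alpha * (1 - d) by rewrite mulr_gt0 ?subr_gt0.
lra.
Qed.

Let gopt := 1 / Num.sqrt (bhat * shat).
Let k := Num.sqrt (bhat / shat).

Let r_gt0 : 0 < Num.sqrt (bhat * shat).
Proof. by rewrite sqrtr_gt0 mulr_gt0. Qed.

Let k_ge1 : 1 <= k.
Proof. by rewrite -[leLHS]sqrtr1 ler_wsqrtr// ler_pdivlMr// mul1r. Qed.

Lemma gopt_gt0 : 0 < gopt.
Proof. by rewrite divr_gt0. Qed.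

(* With [r = sqrt (bhat shat)], the substitution [bhat = r k], [shat = r / k]
   makes [dhat] invariant under [gamma r |-> 1 / (gamma r)]. *)
Let bhatE : bhat = Num.sqrt (bhat * shat) * k.
Proof.
rewrite /k -sqrtrM ?mulr_ge0 ?ltW//.
have -> : bhat * shat * (bhat / shat) = bhat ^+ 2 by field; rewrite gt_eqF.
by rewrite sqrtr_sqr gtr0_norm.
Qed.

Let shatE : shat = Num.sqrt (bhat * shat) / k.
Proof.
have k0 : k != 0 by rewrite gt_eqF// (lt_le_trans ltr01).
have e : bhat * shat = shat ^+ 2 * (bhat / shat) by field; rewrite gt_eqF.
by apply: (mulIf k0); rewrite divfK// e sqrtrM ?sqr_ge0// sqrtr_sqr gtr0_norm.
Qed.

Lemma dhat_gopt : dhat bhat shat gopt = (k - 1) / (k + 1).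
Proof.
have r0 := r_gt0; have k0 : 0 < k by exact: lt_le_trans k_ge1.
have e1 : gopt * bhat = k.
  by rewrite /gopt {2}bhatE; field; rewrite gt_eqF.
have e2 : gopt * shat = k^-1.
  by rewrite /gopt {2}shatE; field; rewrite !gt_eqF.
rewrite /dhat e1 e2 (addrC 1).
have -> : (1 - k^-1) / (1 + k^-1) = (k - 1) / (k + 1).
  by field; rewrite !gt_eqF// addr_gt0.
exact: maxxx.
Qed.

(** With [u = gamma sqrt (bhat shat)], the first argument of the maximum
    increases with [u] and the second decreases, and they agree at [u = 1]. *)
Lemma dhat_gopt_lt gamma : 0 < gamma -> gamma != gopt ->
  dhat bhat shat gopt < dhat bhat shat gamma.
Proof.
move=> g0 gN; have r0 := r_gt0.
have k0 : 0 < k by exact: lt_le_trans k_ge1.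
have [u uE] : exists u, u = gamma * Num.sqrt (bhat * shat) by eexists.
have gb : gamma * bhat = u * k by rewrite [in LHS]bhatE uE mulrA.
have gs : gamma * shat = u / k by rewrite [in LHS]shatE uE mulrA.
have u0 : 0 < u by rewrite uE mulr_gt0.
have u1 : u != 1.
  apply/eqP => u1; move/eqP : gN; apply.
  by rewrite /gopt -u1 uE mulfK// gt_eqF.
rewrite dhat_gopt /dhat gb gs lt_max.
have d1 : 0 < 1 + u * k by rewrite addr_gt0 ?mulr_gt0.
have d2 : 0 < k + u by rewrite addr_gt0.
have k1 : 0 < k + 1 by rewrite addr_gt0.
have -> : (1 - u / k) / (1 + u / k) = (k - u) / (k + u).
  by field; rewrite !gt_eqF.
rewrite !ltr_pdivrMr// ![_ / _ * (k + 1)]mulrAC !ltr_pdivlMr//.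
apply/orP; case: (ltgtP u 1) u1 => // u1 _; [right|left].
  have : 0 < k * (1 - u) by rewrite mulr_gt0 ?subr_gt0.
  lra.
have : 0 < k * (u - 1) by rewrite mulr_gt0 ?subr_gt0.
lra.
Qed.

Lemma dhat_gopt_le gamma : 0 < gamma ->
  dhat bhat shat gopt <= dhat bhat shat gamma.
Proof.
move=> g0; have [->//|gN] := eqVneq gamma gopt.
by rewrite ltW// dhat_gopt_lt.
Qed.

(** The excess of the rate over its optimal value splits into a contribution of
    [alpha] and one of [gamma], both nonnegative and vanishing only at the
    optimum. *)
Lemma rate_gap gamma alpha : admissible bhat shat gamma alpha ->
  exists2 e, 0 < e & rate bhat shat gamma alpha - dhat bhat shat gopt =
    `|1 - alpha| * e + (dhat bhat shat gamma - dhat bhat shat gopt).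
Proof.
move=> [g0 _]; have /andP[d0 d1] := dhat_ge0_lt1 s0 sb g0.
rewrite /rate; move: (dhat _ _ gamma) d0 d1 => d d0 d1.
have [a1|a1] := ger0P (1 - alpha); last first.
  by exists (1 + d); lra.
by exists (1 - d); lra.
Qed.

Lemma admissible_opt : admissible bhat shat gopt 1.
Proof.
have /andP[d0 d1] := dhat_ge0_lt1 s0 sb gopt_gt0.
split; first exact: gopt_gt0.
rewrite ltr01/= ltr_pdivlMr ?mul1r//; lra.
Qed.

Lemma rate_opt : rate bhat shat gopt 1 = (k - 1) / (k + 1).
Proof. by rewrite /rate subrr normr0 add0r mul1r dhat_gopt. Qed.

Lemma rate_minimizer gamma alpha :
  (admissible bhat shat gamma alpha /\
   forall gamma' alpha' : R, admissible bhat shat gamma' alpha' ->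
     rate bhat shat gamma alpha <= rate bhat shat gamma' alpha')
  <-> gamma = gopt /\ alpha = 1.
Proof.
have rE : rate bhat shat gopt 1 = dhat bhat shat gopt.
  by rewrite rate_opt dhat_gopt.
split=> [[adm min]|[-> ->]]; last first.
  split=> [|g a adm]; first exact: admissible_opt.
  have [e e0 eE] := rate_gap adm.
  rewrite rE -subr_ge0 eE addr_ge0 ?mulr_ge0 ?(ltW e0)// subr_ge0.
  by rewrite dhat_gopt_le//; case: adm.
have [e e0 eE] := rate_gap adm; have [g0 _] := adm.
have := min _ _ admissible_opt; rewrite rE -subr_le0 eE => le0.
have gE : gamma = gopt.
  apply/eqP; apply: contraLR le0 => gN; rewrite -ltNge.
  by rewrite ltr_wpDl ?mulr_ge0 ?(ltW e0)// subr_gt0 dhat_gopt_lt.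
split=> //; move: le0; rewrite gE subrr addr0 pmulr_lle0// normr_le0 subr_eq0.
by move/eqP.
Qed.

End rate_theory.

(** * Fixed-point iterations *)
Section fixed_point_iteration.
Context {R : realType} {K : hilbertType R}.

Lemma linear_rate_cvg (rho : R) (z : nat -> K) (zbar : K) : 0 <= rho < 1 ->
  (forall k, `|z k.+1 - zbar| <= rho * `|z k - zbar|) ->
  z k @[k --> \oo] --> zbar.
Proof.
move=> /andP[r0 r1] h.
have hk k : `|z k - zbar| <= geometric `|z 0%N - zbar| rho k.
  elim: k => [|k IH] /=; first by rewrite expr0 mulr1.
  by rewrite (le_trans (h k))// exprS mulrCA ler_wpM2l.
apply/cvgrPdist_le => e e0; near=> k.
rewrite distrC (le_trans (hk k))// (le_trans (ler_norm _))//.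
near: k; have := @cvg_geometric R `|z 0%N - zbar| rho; rewrite ger0_norm// => /(_ r1).
by move=> /cvgr0_norm_le; apply.
Unshelve. all: by end_near. Qed.

Lemma lipschitz_fixed_point (q : R) (T : K -> K) : 0 <= q < 1 ->
  (forall x y, `|T x - T y| <= q * `|x - y|) -> exists x, T x = x.
Proof.
move=> /andP[q0 q1] hT.
pose U : set K := setT.
have ctr : is_contraction (totalfun T : {fun [set: K] >-> [set: K]}).
  by exists (NngNum q0); split => //= -[x y] _ /=; exact: hT.
have [p _ fp] := banach_fixed_point ctr closedT (ex_intro _ 0 I).
by exists p.
Qed.

Lemma averaged_contraction (alpha q : R) (T : K -> K) (z zbar : K) :
  0 <= alpha -> T zbar = zbar -> `|T z - T zbar| <= q * `|z - zbar| ->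
  `|(1 - alpha) *: z + alpha *: T z - zbar| <=
  (`|1 - alpha| + alpha * q) * `|z - zbar|.
Proof.
move=> a0 Tz hT.
have -> : (1 - alpha) *: z + alpha *: T z - zbar =
    (1 - alpha) *: (z - zbar) + alpha *: (T z - T zbar).
  by rewrite Tz; apply: inner_ext => y; rewrite !innerE; ring.
rewrite (le_trans (ler_normD _ _))// !normrZ (ger0_norm a0) mulrDl lerD2l.
by rewrite -mulrA ler_wpM2l.
Qed.

End fixed_point_iteration.

(** * Equivalence with ADMM *)
Section admm_equivalence.
Context {R : realType} {H1 H2 K : hilbertType R}.
Variables (f : H1 -> \bar R) (g : H2 -> \bar R).
Variables (A : {linear H1 -> K}) (B : {linear H2 -> K}) (c : K).
Hypotheses (fpcc : proper_closed_convex f) (gpcc : proper_closed_convex g).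
Hypotheses (Abnd : bounded_near A (nbhs (0 : H1))).
Hypotheses (Bbnd : bounded_near B (nbhs (0 : H2))).
Variables gamma alpha : R.
Hypothesis gamma0 : 0 < gamma.

Lemma dual2E : dual2 g B = dual1 g B 0.
Proof. by apply/funext => mu; rewrite /dual1 inner0l adde0. Qed.

Lemma prox_dual2_argmin w y :
  is_argmin (fun y' =>
    g y' + (gamma / 2 * `|B y' + gamma^-1 *: w| ^+ 2)%:E)%E y ->
  prox gamma (dual2 g B) w = w + gamma *: B y.
Proof.
have [gp _ /convex_epi gcv] := gpcc.
move=> ymin; rewrite dual2E -[B y]subr0; apply: admm_step_prox => // y'.
by rewrite !subr0; exact: ymin.
Qed.

Lemma refl_prox_dual1_argmin w x :
  is_argmin (fun x' =>
    f x' + (gamma / 2 * `|A x' - c + gamma^-1 *: w| ^+ 2)%:E)%E x ->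
  refl_prox gamma (dual1 f A c) w = w + (2 * gamma) *: (A x - c).
Proof.
have [fp _ /convex_epi fcv] := fpcc.
move=> xmin; rewrite /refl_prox (admm_step_prox Abnd fp gamma0 fcv xmin).
by apply: inner_ext => z; rewrite !innerE; ring.
Qed.

Lemma admm_x_residual y u x' :
  A x' - c + gamma^-1 *: (gamma *: (u + B y)) = A x' + B y - c + u.
Proof. by apply: inner_ext => z; rewrite !innerE; field; rewrite gt_eqF. Qed.

Lemma refl_prox_dual2_admm z y u : z = gamma *: (u - B y) ->
  prox gamma (dual2 g B) z = gamma *: u ->
  refl_prox gamma (dual2 g B) z = gamma *: (u + B y).
Proof.
move=> zE pE; rewrite /refl_prox pE zE.
by apply: inner_ext => t; rewrite !innerE; ring.
Qed.

(** The common core of both directions of the equivalence: one averaged step,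
    computed from a minimizer of the [x]-subproblem, is exactly the argument of
    the next [y]-subproblem. *)
Lemma dr_step_admm z x y u : z = gamma *: (u - B y) ->
  prox gamma (dual2 g B) z = gamma *: u ->
  is_argmin (fun x' =>
    f x' + (gamma / 2 * `|A x' + B y - c + u| ^+ 2)%:E)%E x ->
  (1 - alpha) *: z +
    alpha *: refl_prox gamma (dual1 f A c) (refl_prox gamma (dual2 g B) z) =
  gamma *: (u + admm_xA A B c alpha x y - c).
Proof.
move=> zE pE xmin; rewrite (refl_prox_dual2_admm zE pE).
rewrite (@refl_prox_dual1_argmin _ x); last first.
  by move=> x'; rewrite !admm_x_residual; exact: xmin.
by rewrite zE /admm_xA; apply: inner_ext => t; rewrite !innerE; ring.
Qed.

(** The relation [prox (z k) = gamma u k] holds from [k = 1] on, since it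
    expresses that [y k] solves a [y]-subproblem; the initial [y 0] and [u 0] are
    unconstrained, so at [k = 0] it is an assumption. *)
Lemma admm_iteration_dr x y u :
  admm_iteration f g A B c gamma alpha x y u ->
  let z := admm_z B gamma y u in
  (forall k, prox gamma (dual2 g B) (z k.+1) = gamma *: u k.+1) /\
  (forall k, prox gamma (dual2 g B) (z k) = gamma *: u k ->
     z k.+1 = (1 - alpha) *: z k + alpha *: refl_prox gamma (dual1 f A c)
       (refl_prox gamma (dual2 g B) (z k))).
Proof.
move=> adm z.
have zS k : z k.+1 = gamma *: (u k + admm_xA A B c alpha (x k.+1) (y k) - c).
  have [_ _ uS] := adm k; rewrite /z /admm_z uS.
  by apply: inner_ext => t; rewrite !innerE; ring.
split=> k; have [xmin ymin uS] := adm k; last first.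
  by move=> pE; rewrite zS (dr_step_admm _ pE xmin).
rewrite (@prox_dual2_argmin _ (y k.+1)) /z /admm_z.
  by apply: inner_ext => t; rewrite !innerE; ring.
move=> y'; have := ymin y'.
have e b : b + gamma^-1 *: z k.+1 =
    admm_xA A B c alpha (x k.+1) (y k) + b - c + u k.
  by rewrite zS; apply: inner_ext => t; rewrite !innerE; field; rewrite gt_eqF.
by rewrite -!/(z k.+1) !e.
Qed.

Hypothesis x_exists : forall w, exists x, is_argmin (fun x' =>
  f x' + (gamma / 2 * `|A x' - c + gamma^-1 *: w| ^+ 2)%:E)%E x.

(** The [y]-iterates are given by the assumed minimizers and [u] is then
    determined by [z k = gamma (u k - B (y k))]. *)
Lemma dr_iteration_admm z :
  dr_iteration gamma alpha (dual1 f A c) (dual2 g B) z ->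
  (forall k, exists y, is_argmin (fun y' =>
     g y' + (gamma / 2 * `|B y' + gamma^-1 *: z k| ^+ 2)%:E)%E y) ->
  exists x y u, [/\ admm_iteration f g A B c gamma alpha x y u,
    forall k, z k = admm_z B gamma y u k
    & prox gamma (dual2 g B) (z 0%N) = gamma *: u 0%N].
Proof.
move=> dr /choice[y ymin].
have [u uE] : exists u, forall k, u k = gamma^-1 *: z k + B (y k).
  by exists (fun k => gamma^-1 *: z k + B (y k)).
have zE k : z k = gamma *: (u k - B (y k)).
  by rewrite uE; apply: inner_ext => t; rewrite !innerE; field; rewrite gt_eqF.
have pE k : prox gamma (dual2 g B) (z k) = gamma *: u k.
  rewrite (prox_dual2_argmin (ymin k)) uE.
  by apply: inner_ext => t; rewrite !innerE; field; rewrite gt_eqF.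
have /choice[X Xmin] : forall k, exists x, is_argmin (fun x' =>
    f x' + (gamma / 2 * `|A x' + B (y k) - c + u k| ^+ 2)%:E)%E x.
  move=> k; have [x xmin] := x_exists (gamma *: (u k + B (y k))).
  by exists x => x'; have := xmin x'; rewrite !admm_x_residual.
exists (fun k => if k is k'.+1 then X k' else 0), y, u; split => // k.
have zS : gamma^-1 *: z k.+1 = u k + admm_xA A B c alpha (X k) (y k) - c.
  by rewrite dr (dr_step_admm (zE k) (pE k) (Xmin k)) scalerA mulVf ?gt_eqF// scale1r.
split; first exact: Xmin.
- move=> y'; have := ymin k.+1 y'; rewrite zS.
  have e b : b + (u k + admm_xA A B c alpha (X k) (y k) - c) =
      admm_xA A B c alpha (X k) (y k) + b - c + u k.
    by apply: inner_ext => t; rewrite !innerE; ring.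
  by rewrite !e.
- by rewrite uE zS; apply: inner_ext => t; rewrite !innerE; ring.
Qed.

End admm_equivalence.

(** * Linear convergence and optimal parameters *)

Theorem corollary2 (R : realType) (H1 H2 K : hilbertType R)
    (hK : exists mu : K, mu != 0)
    (sigma beta : R) (hsigma : 0 < sigma) (hsb : sigma <= beta)
    (f : H1 -> \bar R) (g : H2 -> \bar R)
    (hf : proper_closed_convex f) (hg : proper_closed_convex g)
    (A : {linear H1 -> K}) (B : {linear H2 -> K})
    (hA : bounded_near A (nbhs (0 : H1)))
    (hB : bounded_near B (nbhs (0 : H2)))
    (c : K)
    (fsmooth : smooth beta f) (fsc : strongly_convex sigma f)
    (Asurj : forall mu : K, exists x : H1, A x = mu)
    (theta : R) (htheta : 0 < theta)
    (hAtheta : forall mu : K, theta * `|mu| <= `|adjoint A mu|)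
    (hd2 : proper_fun (dual2 g B)) :
  let d1 := dual1 f A c in
  let d2 := dual2 g B in
  let nA := op_norm (adjoint A) in
  let bhat := nA ^+ 2 / sigma in
  let shat := theta ^+ 2 / beta in
  let kappa := bhat / shat in
  let gopt := 1 / Num.sqrt (bhat * shat) in
  [/\ proper_closed_convex d1 /\ proper_closed_convex d2,

      (* linear convergence of the iteration *)
      forall gamma alpha : R, admissible bhat shat gamma alpha ->
        (exists zbar : K,
           refl_prox gamma d1 (refl_prox gamma d2 zbar) = zbar) /\
        (forall zbar : K,
           refl_prox gamma d1 (refl_prox gamma d2 zbar) = zbar ->
         forall z : nat -> K, dr_iteration gamma alpha d1 d2 z ->
           (forall k, `|z k.+1 - zbar| <=
                      rate bhat shat gamma alpha * `|z k - zbar|) /\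
           z k @[k --> \oo] --> zbar),

      (* equivalence with ADMM *)
      forall gamma alpha : R, admissible bhat shat gamma alpha ->
        (forall (x : nat -> H1) (y : nat -> H2) (u : nat -> K),
           admm_iteration f g A B c gamma alpha x y u ->
           let z := admm_z B gamma y u in
           dr_iteration gamma alpha d1 d2 (fun k => z k.+1) /\
           (prox gamma d2 (z 0%N) = gamma *: u 0%N ->
            dr_iteration gamma alpha d1 d2 z)) /\
        (forall z : nat -> K, dr_iteration gamma alpha d1 d2 z ->
           (forall k, exists y : H2, is_argmin (fun y' =>
              g y' + (gamma / 2 * `|B y' + gamma^-1 *: z k| ^+ 2)%:E)%E y) ->
           exists (x : nat -> H1) (y : nat -> H2) (u : nat -> K),
             [/\ admm_iteration f g A B c gamma alpha x y u,
                 forall k, z k = admm_z B gamma y u k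
               & prox gamma d2 (z 0%N) = gamma *: u 0%N])

      (* optimal parameters *)
    & [/\ gopt = Num.sqrt (beta * sigma) / (nA * theta),
          kappa = nA ^+ 2 * beta / (theta ^+ 2 * sigma),
          (forall gamma alpha : R,
             (admissible bhat shat gamma alpha /\
              forall gamma' alpha' : R, admissible bhat shat gamma' alpha' ->
                rate bhat shat gamma alpha <= rate bhat shat gamma' alpha')
             <-> gamma = gopt /\ alpha = 1)
        & rate bhat shat gopt 1 =
          (Num.sqrt kappa - 1) / (Num.sqrt kappa + 1)]].
Proof.
move=> d1 d2 nA bhat shat kappa gopt.
have beta0 : 0 < beta := lt_le_trans hsigma hsb.
have le_nA := adjoint_op_norm hA.
have theta_nA : theta <= nA.
  have [mu mu0] := hK; have mu1 : 0 < `|mu| by rewrite normr_gt0.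
  by rewrite -(ler_pM2r mu1) (le_trans (hAtheta mu)).
have nA0 : 0 < nA := lt_le_trans htheta theta_nA.
have s0 : 0 < shat by rewrite divr_gt0// exprn_gt0.
have s_le_b : shat <= bhat.
  apply: ler_pM; rewrite ?invr_ge0 ?sqr_ge0 ?(ltW beta0)//.
    by rewrite ler_pXn2r ?nnegrE ?(ltW htheta) ?(ltW nA0).
  by rewrite lef_pV2 ?posrE.
have d1pcc : proper_closed_convex d1.
  exact: (dual1_proper_closed_convex c hf hA fsc hsigma ltr01).
have d2pcc : proper_closed_convex d2.
  split=> //; rewrite /d2 dual2E; first by apply: dual1_closed => //; case: hg.
  by apply: dual1_convex => //; case: hg.
have contr gamma z z' : 0 < gamma ->
    `|refl_prox gamma d1 (refl_prox gamma d2 z) -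
      refl_prox gamma d1 (refl_prox gamma d2 z')| <=
    dhat bhat shat gamma * `|z - z'|.
  move=> g0; have /andP[dh0 _] := dhat_ge0_lt1 s0 s_le_b g0.
  apply: le_trans (refl_prox_dual1_contraction c hf hA fsc hsigma g0 fsmooth hsb
    htheta hAtheta s_le_b _ _) _.
  by rewrite ler_wpM2l// refl_prox_nonexpansive.
split.
- by [].
- move=> gamma alpha adm; have [g0 /andP[a0 _]] := adm.
  split.
    exact: (lipschitz_fixed_point (dhat_ge0_lt1 s0 s_le_b g0)
      (fun z z' => contr gamma z z' g0)).
  move=> zbar fixz z dr.
  have step k : `|z k.+1 - zbar| <= rate bhat shat gamma alpha * `|z k - zbar|.
    rewrite dr; apply: (averaged_contraction
      (T := fun z => refl_prox gamma d1 (refl_prox gamma d2 z)) (ltW a0) fixz).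
    exact: contr.
  by split=> //; exact: linear_rate_cvg (rate_ge0_lt1 s0 s_le_b adm) step.
- move=> gamma alpha [g0 _]; split; last first.
    move=> z; apply: dr_iteration_admm => // w.
    exact: (admm_step_exists c hf hA fsc hsigma g0 w).
  move=> x y u adm z.
  have [proxS step] := admm_iteration_dr hf hg hA hB g0 adm.
  split=> [k|prox0 [|k]]; exact/step.
- have nT : 0 < nA * theta by rewrite mulr_gt0.
  have kE : kappa = nA ^+ 2 * beta / (theta ^+ 2 * sigma).
    by rewrite /kappa /bhat /shat; field; rewrite !gt_eqF.
  split=> //.
  + have e : bhat * shat = (nA * theta) ^+ 2 / (beta * sigma).
      by rewrite /bhat /shat; field; rewrite !gt_eqF.
    rewrite /gopt e sqrtrM ?sqr_ge0// sqrtr_sqr gtr0_norm// sqrtrV.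
      by rewrite div1r invfM invrK mulrC.
    by rewrite mulr_ge0 ?ltW.
  + exact: rate_minimizer.
  + exact: rate_opt.
Qed.
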